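(* Let $p>1$ and let $\psi:[0,1]\to\mathbb{R}$ be continuous with $\psi(0)<0$, $\psi(1)<0$, and $\psi(x_0)>0$ for some $x_0\in(0,1)$. Suppose that $$\inf_{v\in M_{\rm sym}(\psi)}\mathcal{E}_p(v)<c_p^p,\qquad c_p:=2\int_0^\infty\frac{dt}{(1+t^2)^{\frac32-\frac1{2p}}}.$$ Then there exists a minimizer $u\in M_{\rm sym}(\psi)$ of $\mathcal{E}_p$ in $M_{\rm sym}(\psi)$.
   Context: $\mathcal{E}_p(u):=\int_0^1|\kappa_u|^p\sqrt{1+(u')^2}\,dx$ with $\kappa_u=u''/(1+(u')^2)^{3/2}$. $M(\psi) := \{ v \in W^{2,p}(0,1)\cap W^{1,p}_0(0,1) : v \ge \psi \text{ on } [0,1]\}$ and $M_{\rm sym}(\psi) := \{ v\in M(\psi) : v(x)=v(1-x) \text{ for } x\in[0,1]\}$. *)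

(* Defs.v *)
From HB Require Import structures.
From mathcomp Require Import all_boot all_order all_algebra.
From mathcomp Require Import all_classical all_reals all_analysis.
Set Implicit Arguments. Unset Strict Implicit. Unset Printing Implicit Defensive.
Import Order.TTheory GRing.Theory Num.Theory.
Import numFieldNormedType.Exports.
Local Open Scope classical_set_scope.
Local Open Scope ring_scope.

Section Defs.
Variable R : realType.
Local Notation mu := (@lebesgue_measure R).

Definition Lp01 (p : R) (w : R -> R) : Prop :=
  measurable_fun `[(0:R)%R, (1:R)%R] w /\
  (\int[mu]_(x in `[(0:R)%R, (1:R)%R]) (`|w x| `^ p)%:E < +oo)%E.

(* u (continuous representative on [0,1]) lies in W^{2,p}(0,1) with weak
   second derivative w: u' is absolutely continuous, u'(x) = b + int_0^x w,
   u(x) = u(0) + int_0^x u', and w in L^p(0,1). *)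
Definition W2p_with (p : R) (u w : R -> R) : Prop :=
  Lp01 p w /\
  exists b : R, forall x : R, 0 <= x <= 1 ->
    u x = u 0 + Rintegral mu `[(0:R)%R, x]
                  (fun s => b + Rintegral mu `[(0:R)%R, s] w).

Definition inW2p (p : R) (u : R -> R) : Prop := exists w, W2p_with p u w.

(* M(psi) = W^{2,p}(0,1) cap W^{1,p}_0(0,1) with v >= psi on [0,1] *)
Definition M_obst (p : R) (psi : R -> R) (v : R -> R) : Prop :=
  inW2p p v /\ v 0 = 0 /\ v 1 = 0 /\
  (forall x : R, 0 <= x <= 1 -> psi x <= v x).

Definition M_sym (p : R) (psi : R -> R) (v : R -> R) : Prop :=
  M_obst p psi v /\ (forall x : R, 0 <= x <= 1 -> v x = v (1 - x)).

(* curvature kappa_u = u'' / (1 + u'^2)^(3/2), with u'' the weak second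
   derivative w *)
Definition curv (u w : R -> R) (x : R) : R :=
  w x / (1 + (derive1 u x) ^+ 2) `^ (3%:R / 2%:R).

Definition Ep (p : R) (u w : R -> R) : \bar R :=
  (\int[mu]_(x in `[(0:R)%R, (1:R)%R])
     ((`|curv u w x| `^ p) * Num.sqrt (1 + (derive1 u x) ^+ 2))%:E)%E.

(* c_p = 2 int_0^oo (1+t^2)^{-(3/2 - 1/(2p))} dt  (finite for p > 1) *)
Definition cp (p : R) : R :=
  2 * fine (\int[mu]_(t in `[(0:R)%R, +oo[)
              ((1 + t ^+ 2) `^ (- (3%:R / 2%:R - 1 / (2 * p))))%:E)%E.

Definition Esym_values (p : R) (psi : R -> R) : set (\bar R) :=
  [set e | exists v w, M_sym p psi v /\ W2p_with p v w /\ e = Ep p v w].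

End Defs.

(* Main.v *)
(** The substitution [h = G \o u'], where [G' t = (1 + t^2)^(-(3/2 - 1/(2p)))],
    turns the elastic energy into the convex functional [int |h'|^p].  Symmetry
    makes [h] odd about [1/2], so Hoelder's inequality on [[x, 1 - x]] gives
    [2 |h| <= E_p(u)^(1/p)]; below the level [c_p = 2 G(+oo)] this bounds the
    slopes of a minimizing sequence uniformly and makes them equicontinuous.

    Pointwise limits are taken along a non-principal ultrafilter [U], so that no
    subsequence has to be extracted.  The set function [A |-> lim_U int_A h_n'] is
    a charge dominated by Lebesgue measure, because Hoelder's inequality bounds it
    by a power of the measure of [A]; its Radon-Nikodym density is the weak limit
    of [h_n'], and comparing with [int_A |h_n'|^p] on the level sets of simple
    functions below the density gives lower semicontinuity.  Undoing the
    substitution yields the minimizer. *)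

Require Import Defs.
From HB Require Import structures.
From mathcomp Require Import all_boot all_order all_algebra.
From mathcomp Require Import finmap.
From mathcomp Require Import all_classical all_reals all_analysis.
From mathcomp Require Import measurable_realfun.
From mathcomp Require Import ring lra.
Set Implicit Arguments.
Unset Strict Implicit.
Unset Printing Implicit Defensive.
Import Order.TTheory GRing.Theory Num.Theory.
Import numFieldNormedType.Exports.
Local Open Scope classical_set_scope.
Local Open Scope ring_scope.

(** * Hoelder's inequality *)

Section lp_integrals.
Context {d : measure_display} {T : measurableType d} {R : realType}.
Variable mu : {measure set T -> \bar R}.
Implicit Types (p : R) (A : set T) (f : T -> R).

Lemma measurable_fun_normr_powR p A f :
  measurable_fun A f -> measurable_fun A (fun x => `|f x| `^ p).
Proof.
move=> mf.
apply: (measurableT_comp (@measurable_powR R p)); exact: measurableT_comp mf.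
Qed.

Lemma integrable_normr_powR p A f : measurable_fun A f ->
  (\int[mu]_(x in A) (`|f x| `^ p)%:E < +oo)%E ->
  mu.-integrable A (EFin \o (fun x => `|f x| `^ p)).
Proof.
move=> mf lt; apply/integrableP; split.
  exact/measurable_EFinP/measurable_fun_normr_powR.
rewrite (eq_integral (fun x => (`|f x| `^ p)%:E))// => x _ /=.
by rewrite ger0_norm// powR_ge0.
Qed.

(** Domination by [1 + |f|^p], whose constant part is integrable because [mu A] is finite. *)
Lemma powR_integrable p A f : 1 <= p -> measurable A -> (mu A < +oo)%E ->
  measurable_fun A f -> mu.-integrable A (EFin \o (fun x => `|f x| `^ p)) ->
  mu.-integrable A (EFin \o f).
Proof.
move=> p1 mA fA mf ifp.
have ic : mu.-integrable A (EFin \o cst (1:R)).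
  by apply: measurable_bounded_integrable => //; exact: bounded_cst.
apply: (le_integrable mA _ _ (integrableD mA ic ifp)).
  exact/measurable_EFinP.
move=> x Ax /=; rewrite lee_fin [leRHS]ger0_norm; last first.
  by rewrite addr_ge0// powR_ge0.
have [le1|/ltW ge1] := lerP `|f x| 1.
  by apply: (le_trans le1); rewrite lerDl powR_ge0.
by apply: (le_trans (le1r_powR ge1 p1)); rewrite lerDr.
Qed.

(** Young's inequality for [y] and [t^(p-1)] with exponents [p] and [p/(p-1)]; geometrically, the
    tangent line to the convex function [y^p / p] at [y = t]. *)
Lemma powR_tangent_le p (y t : R) : 1 < p -> 0 <= y -> 0 < t ->
  y * t `^ (p - 1) <= y `^ p / p + t `^ p * (1 - p^-1).
Proof.
move=> p1 y0 t0; have p0 : 0 < p by lra.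
have q0 : p - 1 != 0 by rewrite subr_eq0 gt_eqF.
have pn0 : p != 0 by rewrite gt_eqF.
apply: (le_trans (@conjugate_powR _ y (t `^ (p - 1)) p (p / (p - 1)) _ _ _ _ _)) => //.
- exact: powR_ge0.
- by apply: divr_gt0; lra.
- by field; rewrite ?q0 ?pn0.
- rewrite -powRrM lerD2l.
  have -> : (p - 1) * (p / (p - 1)) = p by field.
  by rewrite le_eqVlt; apply/orP; left; apply/eqP; field; rewrite ?q0 ?pn0.
Qed.

(** Integrating the tangent bound gives inequalities that are linear in the integral of [|f|]; the
    best [t] yields Hoelder's inequality in power form. *)
Lemma Rintegral_powR_le p A f : 1 < p -> measurable A -> (mu A < +oo)%E ->
  measurable_fun A f -> mu.-integrable A (EFin \o (fun x => `|f x| `^ p)) ->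
  (\int[mu]_(x in A) `|f x|) `^ p
    <= fine (mu A) `^ (p - 1) * \int[mu]_(x in A) (`|f x| `^ p).
Proof.
move=> p1 mA fA mf ifp; have p0 : 0 < p by lra.
have if1 := integrable_norm (powR_integrable (ltW p1) mA fA mf ifp).
have if1' : mu.-integrable A (EFin \o (fun x => `|f x|)) by [].
set I := (X in X `^ p <= _); set S := (X in _ <= _ * X); set M := fine (mu A).
have S0 : 0 <= S by apply: Rintegral_ge0 => x _; exact: powR_ge0.
have I0 : 0 <= I by apply: Rintegral_ge0 => x _.
have M0 : 0 <= M by exact: fine_ge0.
have key t : 0 < t -> I * t `^ (p - 1) <= S / p + M * (t `^ p * (1 - p^-1)).
  move=> t0; rewrite /I /S -!RintegralZr// [M * _]mulrC /M -Rintegral_cst//.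
  have ic : mu.-integrable A (EFin \o cst (t `^ p * (1 - p^-1))).
    by apply: measurable_bounded_integrable => //; exact: bounded_cst.
  have ia : mu.-integrable A (EFin \o (fun x => `|f x| `^ p / p)).
    have := integrableZr mA p^-1 ifp.
    by apply: eq_integrable => // x _ /=; rewrite EFinM.
  rewrite -RintegralD//; apply: le_Rintegral => //.
  - have := integrableZr mA (t `^ (p - 1)) if1'.
    by apply: eq_integrable => // x _ /=; rewrite EFinM.
  - have := integrableD mA ia ic.
    by apply: eq_integrable => // x _ /=; rewrite EFinD.
  - by move=> x Ax; exact: powR_tangent_le.
have [->|I0'] := eqVneq I 0.
  rewrite powR0 ?mulr_ge0 ?powR_ge0//; exact: lt0r_neq0.
have Ipos : 0 < I by rewrite lt_neqAle eq_sym I0'.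
have [MZ|M0'] := eqVneq M 0.
  (* [t -> oo] in [key] would force [I = 0] *)
  exfalso; have [t] : exists t, 0 < t /\ S / p < I * t `^ (p - 1).
    (* Chosen so that [I * t^(p-1)] equals [S / p + I]. *)
    exists ((S / p / I + 1) `^ ((p - 1)^-1)); split.
      by apply: powR_gt0; rewrite ltr_pwDr// divr_ge0// divr_ge0// ltW.
    rewrite -powRrM mulVf ?powRr1; last 2 first.
    - by rewrite addr_ge0// divr_ge0// divr_ge0// ltW.
    - by rewrite subr_eq0 gt_eqF.
    by rewrite mulrDr mulr1 [I * _]mulrC divfK// ltrDl.
  by move=> [t0]; have := key _ t0; rewrite MZ mul0r addr0; lra.
have Mpos : 0 < M by rewrite lt_neqAle eq_sym M0'.
(* The optimal tangent point is the mean of [|f|] over [A]. *)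
have t0 : 0 < I / M by exact: divr_gt0.
have := key _ t0.
rewrite !powRM ?invr_ge0// ?mulrA.
have -> : I * I `^ (p - 1) = I `^ p by rewrite mulr_powRB1.
have -> : M^-1 `^ p = M^-1 * M^-1 `^ (p - 1) by rewrite mulr_powRB1// invr_ge0.
have -> : M^-1 `^ (p - 1) = (M `^ (p - 1))^-1.
  by rewrite -[in LHS](powR_inv1 M0) -powRrM mulN1r powRN.
set Q := M `^ (p - 1); have Q0 : 0 < Q by exact: powR_gt0.
rewrite mulrA [M * I `^ p * M^-1]mulrAC divff// mul1r => H.
have {}H : I `^ p / Q * p^-1 <= S * p^-1 by lra.
move: H; rewrite ler_pM2r ?invr_gt0// ler_pdivrMr// => H.
by rewrite mulrC.
Qed.

End lp_integrals.

(** * Weak compactness along an ultrafilter *)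

(** Compactness of the segment gives the image filter a cluster point; an ultrafilter contains each
    set or its complement, so clustering is already convergence. *)
Lemma ultra_bounded_cvg (R : realType) (U : set_system nat) (x : nat -> R) (M : R) :
  UltraFilter U -> (forall n, `|x n| <= M) -> cvg (x @ U).
Proof.
move=> UU xM; have UP : ProperFilter U by exact: ultra_proper.
have xM' : (x @ U) `[- M, M]%classic.
  by apply: (@filterE _ U) => n /=; rewrite in_itv/= -ler_norml.
have [l [_ lx]] := segment_compact (fmap_proper_filter x UP) xM'.
apply/cvg_ex; exists l => N Nl.
have [//|UN] := in_ultra_setVsetC (x @^-1` N) UU.
have [y [Ny Ny']] := lx _ _ (UN : (x @ U) (~` N)) Nl.
by [].
Qed.

(** Turns the Hoelder bound into a modulus of continuity in [m]. The radius solves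
    [r^(p-1) = e^p / (C + 1)]; the added [1] keeps it positive when [C = 0]. *)
Lemma powR_modulus (R : realType) (p C e : R) : 1 < p -> 0 <= C -> 0 < e ->
  exists2 r, 0 < r & forall m y, 0 <= m < r -> 0 <= y ->
    y `^ p <= m `^ (p - 1) * C -> y <= e.
Proof.
move=> p1 C0 e0; have C1 : 0 < C + 1 by rewrite ltr_pwDr.
have p0 : 0 < p by lra.
have q0 : 0 < p - 1 by lra.
have a0 : 0 < e `^ p / (C + 1) by rewrite divr_gt0// powR_gt0.
exists ((e `^ p / (C + 1)) `^ (p - 1)^-1); first exact: powR_gt0.
move=> m y /andP[m0 mr] y0 H; rewrite leNgt; apply/negP => ey.
have /(gt0_ltr_powR p0) := ey; rewrite !nnegrE => /(_ (ltW e0) y0).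
apply/negP; rewrite -leNgt; apply: (le_trans H).
have /(gt0_ltr_powR q0) := mr; rewrite !nnegrE => /(_ m0 (powR_ge0 _ _)).
rewrite -powRrM mulVf ?gt_eqF// (powRr1 (ltW a0)) => mr'.
apply: (le_trans (ler_wpM2r C0 (ltW mr'))).
rewrite -mulrA ler_piMr ?powR_ge0// mulrC ler_pdivrMr// mul1r; lra.
Qed.

Section weak_compactness.
Context {d : measure_display} {T : measurableType d} {R : realType}.
Variable mu : {sigma_finite_measure set T -> \bar R}.
Variables (D : set T) (p C : R) (U : set_system nat) (f : nat -> T -> R).
Hypotheses (mD : measurable D) (fD : (mu D < +oo)%E) (p1 : 1 < p).
Hypothesis UU : UltraFilter U.
Hypothesis mf : forall n, measurable_fun D (f n).
Hypothesis ifp : forall n, mu.-integrable D (EFin \o (fun x => `|f n x| `^ p)).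
Hypothesis fC : forall n, \int[mu]_(x in D) (`|f n x| `^ p) <= C.

Let C0 : 0 <= C.
Proof. by apply: le_trans (fC 0); apply: Rintegral_ge0 => x _; exact: powR_ge0. Qed.

Let mI A : measurable A -> measurable (A `&` D).
Proof. by move=> mA; exact: measurableI. Qed.

Let fI A : measurable A -> (mu (A `&` D) < +oo)%E.
Proof.
move=> mA; apply: le_lt_trans fD; apply: le_measure; rewrite ?inE//; exact: mI.
Qed.

Let ifn n : mu.-integrable D (EFin \o f n).
Proof. by apply: (@powR_integrable _ _ _ mu p) => //; exact: ltW. Qed.

Let ifnI n A : measurable A -> mu.-integrable (A `&` D) (EFin \o f n).
Proof. by move=> mA; apply: integrableS (ifn n) => //; exact: mI. Qed.

Let ifpI n A : measurable A ->
  mu.-integrable (A `&` D) (EFin \o (fun x => `|f n x| `^ p)).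
Proof. by move=> mA; apply: integrableS (ifp n) => //; exact: mI. Qed.

Let int_powR_le n A : measurable A ->
  `|\int[mu]_(x in A `&` D) f n x| `^ p
    <= fine (mu (A `&` D)) `^ (p - 1) * \int[mu]_(x in A `&` D) (`|f n x| `^ p).
Proof.
move=> mA; have mAD := mI mA.
apply: le_trans (Rintegral_powR_le p1 mAD (fI mA) _ (ifpI n mA)).
  apply: ge0_ler_powR; rewrite ?nnegrE//.
  - exact: ltW (lt_trans ltr01 p1).
  - by apply: Rintegral_ge0.
  - by apply: le_normr_Rintegral => //; exact: ifnI.
exact: measurable_funS (mf n).
Qed.

Let pow_int_le n A : measurable A ->
  0 <= \int[mu]_(x in A `&` D) (`|f n x| `^ p) <= C.
Proof.
move=> mA; rewrite Rintegral_ge0/=; last by move=> x _; exact: powR_ge0.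
apply: le_trans (fC n); rewrite -lee_fin /Rintegral !fineK; last 2 first.
- exact: (integrable_fin_num mD (ifp n)).
- exact: (integrable_fin_num (mI mA) (ifpI n mA)).
apply: ge0_subset_integral => //; first exact: mI.
- exact: (measurable_int _ (ifp n)).
Qed.

(** Uniform absolute continuity: [r] does not depend on [n], so the estimate survives the limit
    along [U]. *)
Let small (e : R) : 0 < e -> exists2 r, 0 < r & forall A n, measurable A ->
  fine (mu (A `&` D)) < r -> `|\int[mu]_(x in A `&` D) f n x| <= e.
Proof.
move=> e0; have [r r0 H] := powR_modulus p1 C0 e0.
exists r => // A n mA Ar; apply: (H (fine (mu (A `&` D)))) => //.
  by rewrite fine_ge0.
apply: (le_trans (int_powR_le n mA)); apply: ler_wpM2l; first exact: powR_ge0.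
by have /andP[] := pow_int_le n mA.
Qed.

(** Intersecting with [D] defines the set function on all measurable sets of [T], as a charge on [T]
    requires. *)
Let nuR (A : set T) : R := lim (\int[mu]_(x in A `&` D) f n x @[n --> U]).

Let nuR_cvg A : measurable A ->
  \int[mu]_(x in A `&` D) f n x @[n --> U] --> nuR A.
Proof.
move=> mA.
apply: (@ultra_bounded_cvg _ _ _ (1 + fine (mu (A `&` D)) `^ (p - 1) * C) UU).
(* Hoelder bounds [y^p]; since [y <= 1] or [y <= y^p], this also bounds [y]. *)
move=> n; set y := `|_|; have [y1|/ltW y1] := lerP y 1.
  by rewrite (le_trans y1)// lerDl mulr_ge0// powR_ge0.
have py : y <= y `^ p by apply: le1r_powR => //; exact: ltW.
apply: (le_trans py); apply: (le_trans (int_powR_le n mA)).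
rewrite ler_wpDl// ler_wpM2l ?powR_ge0//.
by have /andP[] := pow_int_le n mA.
Qed.

Let UP : ProperFilter U. Proof. exact: ultra_proper. Qed.

Let nuR_le A e : measurable A ->
  (forall n, `|\int[mu]_(x in A `&` D) f n x| <= e) -> `|nuR A| <= e.
Proof.
move=> mA H; have /cvg_norm := nuR_cvg mA.
by move=> /cvgr_to_le; apply; exact: nearW.
Qed.

Let nuR0 : nuR set0 = 0.
Proof.
apply/eqP; rewrite -normr_le0; apply: nuR_le => // n.
by rewrite set0I Rintegral_set0 normr0.
Qed.

Let nuRU A B : measurable A -> measurable B -> A `&` B = set0 ->
  nuR (A `|` B) = nuR A + nuR B.
Proof.
move=> mA mB AB; have mAB := measurableU _ _ mA mB.
apply: cvg_lim => //.
apply: cvg_trans (cvgD (nuR_cvg mA) (nuR_cvg mB)); apply: near_eq_cvg.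
apply: nearW => n; rewrite [RHS]/=  setIUl Rintegral_setU//.
- exact: mI.
- exact: mI.
- by rewrite -setIUl; exact: ifnI.
- by apply/eqP; rewrite setIACA AB set0I.
Qed.

Let nuR_small (e : R) : 0 < e -> exists2 r, 0 < r & forall A, measurable A ->
  fine (mu (A `&` D)) < r -> `|nuR A| <= e.
Proof.
move=> e0; have [r r0 H] := small e0; exists r => // A mA Ar.
by apply: nuR_le => // n; exact: H.
Qed.

Definition weak_limit (A : set T) : \bar R := (nuR A)%:E.

Let nu0 : weak_limit set0 = 0%E. Proof. by rewrite /weak_limit nuR0. Qed.

Let nu_fin A : measurable A -> weak_limit A \is a fin_num. Proof. by []. Qed.

(** Finite additivity reduces the claim to the tails of the union. Inside [D] these decrease to the
    empty set, so their measures tend to zero and absolute continuity makes [nuR] small on them. *)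
Let nu_sigma : semi_sigma_additive weak_limit.
Proof.
move=> F mF tF mUF.
have sumE n : (\sum_(0 <= i < n) weak_limit (F i) =
               (nuR (\big[setU/set0]_(i < n) F i))%:E)%E.
  elim: n => [|n IH]; first by rewrite big_geq// big_ord0 nuR0.
  rewrite big_nat_recr//= IH big_ord_recr/= nuRU//.
    exact: bigsetU_measurable.
  rewrite big_distrl/= big1// => i _.
  move/trivIsetP : tF => /(_ i n Logic.I Logic.I); apply.
  by rewrite neq_ltn ltn_ord.
under eq_fun do rewrite sumE.
apply: cvg_EFin; first exact: nearW.
apply/cvgrPdist_le => e e0; have [r r0 H] := nuR_small e0.
pose G n := (\bigcup_i F i `\` \big[setU/set0]_(i < n) F i) `&` D.
have mG n : measurable (\bigcup_i F i `\` \big[setU/set0]_(i < n) F i).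
  by apply: measurableD => //; exact: bigsetU_measurable.
have G0 : \bigcap_n G n = set0.
  apply/seteqP; split => // x GG; have [[[i _ Fix] _] _] := GG 0%N Logic.I.
  have [[_ nFx] _] := GG i.+1 Logic.I; apply: nFx.
  by rewrite -bigcup_mkord; exists i => /=.
have Gcvg : mu \o G @ \oo --> mu (\bigcap_n G n).
  apply: nonincreasing_cvg_mu.
  - exact: fI.
  - by move=> n; exact: mI.
  - by rewrite G0.
  - move=> m n mn; apply/subsetPset; apply: setSI; apply: setDS.
    exact: subset_bigsetU.
move: Gcvg; rewrite G0 measure0 => /fine_cvgP[_] /cvgrPdist_lt/(_ _ r0).
apply: filterS => n; rewrite /= sub0r normrN ger0_norm ?fine_ge0// => /(H _ (mG n)).
suff -> : nuR (\bigcup_i F i) = nuR (\bigcup_i F i `\` \big[setU/set0]_(i < n) F i)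
   + nuR (\big[setU/set0]_(i < n) F i) by rewrite addrK.
rewrite -nuRU//; last 2 first.
- exact: bigsetU_measurable.
- by rewrite setDKI.
congr nuR; rewrite setUC setDUK//.
by rewrite -bigcup_mkord => x [i _ Fix]; exists i.
Qed.

HB.instance Definition _ := isCharge.Build _ _ _ weak_limit nu0 nu_fin nu_sigma.

Let nu_dom : weak_limit `<< mu.
Proof.
move=> N muN A mA AN; congr EFin; apply/eqP; rewrite -normr_le0.
apply: nuR_le => // n; rewrite /Rintegral null_set_integral ?normr0//.
- exact: mI.
- by have /measurable_int := ifnI n mA.
- by apply: muN => [|x [/AN]]//; exact: mI.
Qed.

(** Weak convergence is stated on indicators of measurable subsets of [D], the form used both for
    lower semicontinuity and for the limit on intervals. *)
Lemma weak_limit_density : exists w : T -> R,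
  [/\ measurable_fun D w, mu.-integrable D (EFin \o w) &
   forall A, measurable A -> A `<=` D ->
     \int[mu]_(x in A) f n x @[n --> U] --> \int[mu]_(x in A) w x].
Proof.
pose g := Radon_Nikodym weak_limit mu.
have ig : mu.-integrable D (EFin \o (fine \o g)).
  have := integrableS measurableT mD (@subsetT _ D) (Radon_Nikodym_integrable nu_dom).
  apply: eq_integrable => // x _ /=; rewrite fineK//.
  exact: Radon_Nikodym_fin_num.
exists (fine \o g); split => //.
  by apply/measurable_EFinP; exact: measurable_int ig.
move=> A mA AD; have := nuR_cvg mA; rewrite (setIidl AD).
have -> : nuR A = \int[mu]_(x in A) (fine \o g) x; last by [].
rewrite /Rintegral -[LHS]/(fine (weak_limit A)) (Radon_Nikodym_integral nu_dom mA).
congr fine; apply: eq_integral => x _ /=; rewrite fineK//.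
exact: Radon_Nikodym_fin_num.
Qed.

(** * Weak lower semicontinuity of the integral of [|f|^p] *)

Let lamn n A := \int[mu]_(x in A `&` D) (`|f n x| `^ p).
(** The energy left on [A] in the limit. Finite additivity is enough, because a simple function has
    finitely many level sets. *)
Let lam A : R := lim (lamn n A @[n --> U]).

Let lam_cvg A : measurable A -> lamn n A @[n --> U] --> lam A.
Proof.
move=> mA; apply: (@ultra_bounded_cvg _ _ _ C UU) => n.
by have /andP[? ?] := pow_int_le n mA; rewrite ger0_norm.
Qed.

Let lamU A B : measurable A -> measurable B -> A `&` B = set0 ->
  lam (A `|` B) = lam A + lam B.
Proof.
move=> mA mB AB; have mAB := measurableU _ _ mA mB.
apply: cvg_lim => //.
apply: cvg_trans (cvgD (lam_cvg mA) (lam_cvg mB)); apply: near_eq_cvg.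
apply: nearW => n; rewrite [RHS]/= /lamn setIUl Rintegral_setU//.
- exact: mI.
- exact: mI.
- by rewrite -setIUl; exact: ifpI.
- by apply/eqP; rewrite setIACA AB set0I.
Qed.

Let lam_sum (I : choiceType) (s : seq I) (F : I -> set T) :
  (forall i, measurable (F i)) -> uniq s -> trivIset [set` s] F ->
  D = \big[setU/set0]_(i <- s) F i -> \sum_(i <- s) lam (F i) = lam D.
Proof.
move=> mF us tF DF.
have FD i : i \in s -> F i `<=` D.
  by move=> si x Fx; rewrite DF -bigcup_seq; exists i.
apply/esym; apply: cvg_lim => //.
have -> : (fun n => lamn n D) = (fun n => \sum_(i <- s) lamn n (F i)).
  apply/funext => n; apply: EFin_inj; rewrite -sumEFin /lamn setIid.
  rewrite /Rintegral fineK; last exact: (integrable_fin_num mD (ifp n)).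
  rewrite [in LHS]DF ge0_integral_bigsetU//; last first.
    by have := measurable_int _ (ifp n); rewrite [X in measurable_fun X]DF.
  apply: eq_big_seq => i si; rewrite (setIidl (FD _ si)) fineK//.
  have := integrable_fin_num _ (ifpI n (mF i)).
  by rewrite (setIidl (FD _ si)); apply.
rewrite -[X in _ --> X]/(\sum_(i <- s) lam (F i)).
have : forall i, lamn n (F i) @[n --> U] --> lam (F i) by move=> i; exact: lam_cvg.
by move=> H; apply: cvg_big => //; exact: add_continuous.
Qed.

(** Where [w] keeps one sign, encoded by [b], nothing cancels and the integral of [w] is at least
    [r * mu A] in absolute value. The limit of Hoelder's inequality bounds its [p]-th power by
    [mu(A)^(p-1) * lam A]. *)
Let lam_sign (w : T -> R) A (r : R) (b : bool) :
  mu.-integrable D (EFin \o w) ->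
  (\int[mu]_(x in A) f n x @[n --> U] --> \int[mu]_(x in A) w x) ->
  measurable A -> A `<=` D -> 0 <= r ->
  (forall x, A x -> r <= (-1) ^+ b * w x) ->
  r `^ p * fine (mu A) <= lam A.
Proof.
move=> iw wcv mA AD r0 rw; have AE := setIidl AD.
have p0 : 0 < p by exact: lt_trans ltr01 p1.
have lam0 : 0 <= lam A.
  apply: (cvgr_to_ge (lam_cvg mA)); apply: nearW => n.
  by have /andP[] := pow_int_le n mA.
(* The cases [r = 0] and [mu A = 0] are trivial. Outside them [|I|] is positive, where the power is
   differentiable, and [M^(p-1)] can be divided out. *)
have [->|rn0] := eqVneq r 0; first by rewrite powR0 ?mul0r// gt_eqF.
have [->|Mn0] := eqVneq (fine (mu A)) 0; first by rewrite mulr0.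
set M := fine (mu A); have M0 : 0 < M by rewrite lt_neqAle eq_sym Mn0 fine_ge0.
have {}r0 : 0 < r by rewrite lt_neqAle eq_sym rn0.
have iwA : mu.-integrable A (EFin \o w) by exact: integrableS iw.
have muA : (mu A < +oo)%E by have := fI mA; rewrite AE.
set I := \int[mu]_(x in A) w x.
have rI : r * M <= `|I|.
  have -> : `|I| = `|(-1) ^+ b * I| by rewrite normrM normrX normrN1 expr1n mul1r.
  apply: le_trans (ler_norm _); rewrite /I -RintegralZl// /M -Rintegral_cst//.
  apply: le_Rintegral => //.
  - by apply: measurable_bounded_integrable => //; exact: bounded_cst.
  - have := integrableZl mA ((-1) ^+ b) iwA.
    by apply: eq_integrable => // x _ /=; rewrite EFinM.
have I0 : 0 < `|I| by apply: lt_le_trans rI; exact: mulr_gt0.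
have cI : `|\int[mu]_(x in A) f n x| `^ p @[n --> U] --> `|I| `^ p.
  have cc : {for `|I|, continuous (fun a : R => a `^ p)}.
    apply: differentiable_continuous; apply/derivable1_diffP.
    by apply: derivable_powR; rewrite in_itv/= I0.
  exact: (@cvg_comp _ _ _ _ (fun a : R => a `^ p) _ _ _ (cvg_norm wcv) cc).
have : `|I| `^ p <= M `^ (p - 1) * lam A.
  have c2 := cvgM (cvg_cst (M `^ (p - 1))) (lam_cvg mA).
  apply: (ler_cvg_to cI (c2 _ _)); apply: nearW => n /=.
  by have := int_powR_le n mA; rewrite /lamn AE.
have : (r * M) `^ p <= `|I| `^ p.
  apply: ge0_ler_powR; rewrite ?nnegrE//; first exact: ltW.
  by rewrite mulr_ge0// ltW.
move=> /le_trans/[apply]; rewrite powRM; [|exact: ltW..].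
rewrite -[M `^ p]mulr_powRB1; [|exact: ltW|by []].
by rewrite mulrA [M `^ _ * _]mulrC ler_pM2r// powR_gt0.
Qed.

Import HBNNSimple.

(** For a simple function below [|w|], the estimates on its level sets add up to at most the limit
    energy of [D]; monotone convergence then passes to [|w|]. *)
Lemma weak_limit_powR_le (w : T -> R) (L : R) :
  measurable_fun D w -> mu.-integrable D (EFin \o w) ->
  (forall A, measurable A -> A `<=` D ->
     \int[mu]_(x in A) f n x @[n --> U] --> \int[mu]_(x in A) w x) ->
  \int[mu]_(x in D) (`|f n x| `^ p) @[n --> U] --> L ->
  (\int[mu]_(x in D) (`|w x| `^ p)%:E <= L%:E)%E.
Proof.
move=> mw iw wcv Lcv.
have LE : lam D = L by apply: cvg_lim => //; rewrite /lamn setIid.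
have p0 : 0 < p by exact: lt_trans ltr01 p1.
have lam_level A r : measurable A -> A `<=` D -> 0 <= r ->
    (forall x, A x -> r <= `|w x|) -> r `^ p * fine (mu A) <= lam A.
  move=> mA AD r0 rw.
  (* As [w] may change sign on [A], [lam_sign] is applied to the two sign parts separately. *)
  pose P := A `&` [set x | 0 <= w x]; pose N := A `\` [set x | 0 <= w x].
  have mP : measurable P.
    have -> : P = A `&` w @^-1` `[0, +oo[%classic.
      by apply/seteqP; split => x /=; rewrite in_itv/= andbT.
    by apply: (measurable_funS mD AD mw) => //; exact: measurable_itv.
  have mN : measurable N.
    have -> : N = A `\` P; last exact: measurableD.
    apply/seteqP; split => x [Ax nx]; split => //; first by move=> [_ /nx].
    by move=> wx; exact: nx.
  have PD : P `<=` D by move=> x [/AD].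
  have ND : N `<=` D by move=> x [/AD].
  have PNE : P `|` N = A by rewrite setUIDK.
  have PN0 : P `&` N = set0.
    by apply/seteqP; split => // x [[_ /= ?] [_]].
  have fin B : measurable B -> B `<=` D -> mu B \is a fin_num.
    by move=> mB BD; rewrite ge0_fin_numE//; have := fI mB; rewrite (setIidl BD).
  have -> : fine (mu A) = fine (mu P) + fine (mu N).
    by rewrite -PNE measureU// fineD ?fin.
  rewrite -PNE lamU// mulrDr; apply: lerD.
    apply: (@lam_sign w P r false) => //; first exact: wcv.
    move=> x [Ax /= wx]; rewrite expr0 mul1r.
    by have := rw _ Ax; rewrite ger0_norm.
  apply: (@lam_sign w N r true) => //; first exact: wcv.
  move=> x [Ax /= /negP]; rewrite -ltNge expr1 mulN1r => wx.
  by have := rw _ Ax; rewrite ltr0_norm.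
have mh : measurable_fun D (fun x => `|w x|%:E).
  by apply/measurable_EFinP; exact: measurableT_comp.
have h0 x : D x -> (0 <= `|w x|%:E)%E by rewrite lee_fin.
pose a := nnsfun_approx mD mh.
have ale k x : D x -> a k x <= `|w x|.
  by move=> Dx; rewrite -lee_fin /a nnsfun_approxE; exact: le_approx.
have step k : (\int[mu]_(x in D) (a k x `^ p)%:E <= L%:E)%E.
  pose s := fset_set (range (a k)); pose F r := a k @^-1` [set r] `&` D.
  have mF r : measurable (F r) by exact: measurableI.
  have tF : trivIset [set` s] F.
    by move=> r r' _ _ [x [[<- _] [<- _]]].
  have DF : D = \big[setU/set0]_(r <- s) F r.
    rewrite -bigcup_fset; apply/seteqP; split => x.
      by move=> Dx; exists (a k x) => //=; rewrite in_fset_set ?inE//; exact: fimfunP.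
    by move=> [r _ []].
  rewrite {1}DF ge0_integral_bigsetU//; last 2 first.
  - apply/measurable_EFinP; apply: (measurableT_comp (@measurable_powR R p)).
    exact: measurable_funTS.
  - by move=> x _; rewrite lee_fin powR_ge0.
  rewrite -LE -(lam_sum mF (fset_uniq s) tF DF) -sumEFin.
  apply: lee_sum => r _.
  rewrite (eq_integral (cst (r `^ p)%:E)); last first.
    by move=> x; rewrite inE => -[/= -> _].
  have finF : mu (F r) \is a fin_num by rewrite ge0_fin_numE//; exact: fI.
  rewrite integral_cst// -[X in (_ * X)%E](fineK finF) -EFinM lee_fin.
  have [r0|r0] := leP 0 r.
    apply: lam_level => //; first exact: subIsetr.
    by move=> x [/= <-]; exact: ale.
  (* A negative [r] is not a value of the nonnegative [a k]. *)
  have -> : F r = set0.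
    apply/seteqP; split => // x [/= ar _]; move: r0; rewrite -ar.
    by rewrite ltNge fun_ge0.
  rewrite measure0 mulr0; apply: (cvgr_to_ge (lam_cvg measurable0)).
  by apply: nearW => n; have /andP[] := pow_int_le n measurable0.
have mc : (\int[mu]_(x in D) (a k x `^ p)%:E)%E @[k --> \oo] -->
          (\int[mu]_(x in D) (limn (fun k => (a k x `^ p)%:E)))%E.
  apply: cvg_monotone_convergence => //.
  - move=> k; apply/measurable_EFinP; apply: (measurableT_comp (@measurable_powR R p)).
    exact: measurable_funTS.
  - by move=> k x _; rewrite lee_fin powR_ge0.
  - move=> x Dx m n mn; rewrite lee_fin; apply: ge0_ler_powR.
    + exact: ltW.
    + by rewrite nnegrE fun_ge0.
    + by rewrite nnegrE fun_ge0.
    by have /lefP := nd_nnsfun_approx mD mh mn; exact.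
have -> : (\int[mu]_(x in D) (`|w x| `^ p)%:E =
           \int[mu]_(x in D) (limn (fun k => (a k x `^ p)%:E)))%E.
  apply: eq_integral => x; rewrite inE => Dx; apply/esym/cvg_lim => //.
  apply: cvg_EFin; first exact: nearW.
  have ax : a k x @[k --> \oo] --> `|w x|.
    by have /fine_cvgP[_] := cvg_nnsfun_approx mD mh h0 Dx.
  (* At a zero of [w] all the approximations vanish; elsewhere the power is differentiable, hence
     continuous. *)
  have [w0|w0] := eqVneq `|w x| 0.
    apply: cvg_near_cst; apply: nearW => k /=; congr (_ `^ _); apply/eqP.
    by rewrite eq_le ale//= w0 fun_ge0.
  have cc : {for `|w x|, continuous (fun t : R => t `^ p)}.
    apply: differentiable_continuous; apply/derivable1_diffP.
    by apply: derivable_powR; rewrite in_itv/= andbT lt_neqAle eq_sym w0 normr_ge0.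
  exact: (@cvg_comp _ _ _ _ (fun t : R => t `^ p) _ _ _ ax cc).
by apply: cvge_le mc; exact: nearW.
Qed.
End weak_compactness.

(** * Primitives on the unit interval *)

Section unit_interval.
Context {R : realType}.
Local Notation mu := (@lebesgue_measure R).
Local Notation I01 := (`[(0 : R)%R, (1 : R)%R]%classic).
Implicit Types (f g : R -> R) (x y : R).

(** Summing over a fine subdivision extends the local bound to [|D y - D x| <= e * (W y - W x)] for
    every [e > 0]. This takes the place of an almost everywhere differentiation argument. *)
Lemma small_increments_const (D W : R -> R) :
  (forall e, 0 < e -> exists2 r, 0 < r & forall x y, 0 <= x -> x <= y -> y <= 1 ->
     y - x < r -> `|D y - D x| <= e * (W y - W x)) ->
  forall x y, 0 <= x -> x <= y -> y <= 1 -> D y = D x.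
Proof.
move=> H x y x0 xy y1.
have key e : 0 < e -> `|D y - D x| <= e * (W y - W x).
  move=> e0; have [r r0 {}H] := H _ e0.
  (* [N] exceeds [(y - x) / r], so the steps of the subdivision are shorter than [r]. *)
  pose N := (Num.truncn ((y - x) / r)).+1.
  have N0 : 0 < N%:R :> R by rewrite ltr0n.
  pose s := (y - x) / N%:R.
  have s0 : 0 <= s by rewrite divr_ge0// subr_ge0.
  have sN : s * N%:R = y - x by rewrite divfK// gt_eqF.
  have sr : s < r.
    rewrite ltr_pdivrMr// mulrC -ltr_pdivrMr//.
    exact: truncnS_gt.
  have step i : (i <= N)%N -> `|D (x + s * i%:R) - D x| <= e * (W (x + s * i%:R) - W x).
    elim: i => [|i IH] iN; first by rewrite mulr0 addr0 !subrr normr0 mulr0.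
    have {}IH := IH (ltnW iN).
    have iNR : i.+1%:R <= N%:R :> R by rewrite ler_nat.
    have i0 : 0 <= i%:R :> R by [].
    have A1 := mulr_ge0 s0 i0.
    have A2 : s * i.+1%:R = s * i%:R + s by rewrite -natr1 mulrDr mulr1.
    have A3 : s * i.+1%:R <= s * N%:R by rewrite ler_wpM2l.
    have := H (x + s * i%:R) (x + s * i.+1%:R).
    move=> /(_ _ _ _ _) H1.
    have {}H1 : `|D (x + s * i.+1%:R) - D (x + s * i%:R)| <=
       e * (W (x + s * i.+1%:R) - W (x + s * i%:R)) by apply: H1; lra.
    have -> : D (x + s * i.+1%:R) - D x =
      (D (x + s * i.+1%:R) - D (x + s * i%:R)) + (D (x + s * i%:R) - D x) by ring.
    apply: (le_trans (ler_normD _ _)); lra.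
  by have := step N (leqnn _); rewrite sN [x + _]addrC subrK.
apply/eqP; rewrite -subr_eq0 -normr_le0 leNgt; apply/negP => d0.
have c0 : 0 < `|W y - W x| + 1 by rewrite ltr_pwDr.
(* With this [e] the bound is at most half of [|D y - D x|]; the added [1] covers [W y = W x]. *)
have := key (`|D y - D x| / 2 / (`|W y - W x| + 1)).
rewrite !divr_gt0// => /(_ isT); apply/negP; rewrite -ltNge.
apply: (@le_lt_trans _ _ (`|D y - D x| / 2)); last lra.
rewrite mulrAC ler_pdivrMr// ler_wpM2l//.
have := ler_norm (W y - W x); lra.
Qed.

Lemma Rintegral_itv_split f a x y : a <= x -> x <= y ->
  mu.-integrable `[a, y] (EFin \o f) ->
  Rintegral mu `[a, y] f = Rintegral mu `[a, x] f + Rintegral mu `[x, y] f.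
Proof.
move=> ax xy intf; apply/eqP; rewrite addrC -subr_eq; apply/eqP.
rewrite Rintegral_itvB// ?bnd_simp// Rintegral_itv_obnd_cbnd//.
apply: integrableS intf => //.
by move=> z /=; rewrite !in_itv/= => /andP[/ltW xz ->]; rewrite (le_trans ax xz).
Qed.

Lemma measure_itvcc x y : x <= y -> mu `[x, y]%classic = (y - x)%:E.
Proof.
move=> xy; rewrite lebesgue_measure_itv/= lte_fin; case: ltP => // yx.
have -> : y = x by apply/eqP; rewrite eq_le xy yx.
by rewrite subrr.
Qed.

Lemma Rintegral_cst_approx f c e x y : x <= y -> mu.-integrable `[x, y] (EFin \o f) ->
  (forall s, x <= s -> s <= y -> `|f s - c| <= e) ->
  `|Rintegral mu `[x, y] f - c * (y - x)| <= e * (y - x).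
Proof.
move=> xy intf fc.
have mxy : (mu `[x, y]%classic < +oo)%E by rewrite measure_itvcc// ltry.
have ic k : mu.-integrable `[x, y] (EFin \o cst k).
  by apply: measurable_bounded_integrable => //; exact: bounded_cst.
have E k : k * (y - x) = Rintegral mu `[x, y] (cst k).
  by rewrite Rintegral_cst//= measure_itvcc.
rewrite !E -RintegralB//; last exact: ic.
have ifc : mu.-integrable `[x, y] (EFin \o (fun s => f s - c)).
  have := integrableB _ intf (ic c).
  by move=> /(_ (measurable_itv _)); apply: eq_integrable => // z _ /=; rewrite EFinB.
apply: (le_trans (le_normr_Rintegral _ ifc)) => //.
apply: le_Rintegral => //; [exact: integrable_norm|exact: ic|].
by move=> s; rewrite /= in_itv/= => /andP[]; exact: fc.
Qed.

(** Uniform continuity on [[0, 1]], with ordered points because the estimates come from integrals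
    over [[x, y]]. *)
Definition ucont01 f := forall e, 0 < e -> exists2 r, 0 < r &
  forall x y, 0 <= x -> x <= y -> y <= 1 -> y - x < r -> `|f y - f x| <= e.

Lemma ucont01_sym f e : ucont01 f -> 0 < e -> exists2 r, 0 < r &
  forall x y, 0 <= x <= 1 -> 0 <= y <= 1 -> `|y - x| < r -> `|f y - f x| <= e.
Proof.
move=> cf e0; have [r r0 H] := cf _ e0; exists r => // x y.
wlog xy : x y / x <= y => [hw|].
  have [/hw//|/ltW/hw {}hw h1 h2] := leP x y.
  by rewrite distrC (distrC (f y)); exact: hw.
move=> /andP[x0 _] /andP[_ y1] yx; apply: H => //; exact: le_lt_trans (ler_norm _) yx.
Qed.

(** Composition with the clamp [c] onto [[0, 1]], which is 1-Lipschitz, gives a function continuous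
    on the whole line that agrees with [f] on the interval. *)
Lemma ucont01_within f : ucont01 f -> {within I01, continuous f}.
Proof.
move=> cf; pose c x : R := Order.max 0 (Order.min x 1).
have c01 x : 0 <= c x <= 1.
  by rewrite /c le_max lexx/= ge_max ler01 ge_min lexx orbT.
have cc x y : `|c y - c x| <= `|y - x|.
  have cE z : c z = if z <= 0 then 0 else if z <= 1 then z else 1.
    rewrite /c; case: (leP z 0) => z0.
      by rewrite max_l// ge_min z0.
    case: (leP z 1) => z1; first by rewrite max_r// ltW.
    by rewrite max_r.
  have := ler_norm (y - x); have := ler_norm (x - y); rewrite distrC.
  set n := `|y - x| => ? ?.
  rewrite !cE; case: (leP x 0) => ?; case: (leP y 0) => ?;
    try (case: (leP x 1) => ?); try (case: (leP y 1) => ?);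
    rewrite ?subrr ?normr0// ?ler_norml; try (apply/andP; split); lra.
have : {within I01, continuous (f \o c)}.
  apply: continuous_subspaceT => x; apply/cvgrPdist_le => e e0.
  have [r r0 H] := ucont01_sym cf e0.
  near=> y; rewrite /= distrC; apply: H => //.
  apply: (le_lt_trans (cc _ _)); rewrite distrC; near: y.
  by apply/nbhs_normP; exists r.
apply: subspace_eq_continuous => x; rewrite inE/= in_itv/= => /andP[x0 x1].
by rewrite /from_subspace/comp/= /c min_l// max_r.
Unshelve. all: by end_near. Qed.

Lemma ucont01_measurable f : ucont01 f -> measurable_fun I01 f.
Proof.
by move=> /ucont01_within; apply: subspace_continuous_measurable_fun.
Qed.

Lemma ucont01_bounded f : ucont01 f -> [bounded f x | x in I01].
Proof.
move=> /ucont01_within cf.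
have /compact_bounded[M [_ mrt]] := continuous_compact cf (@segment_compact R 0 1).
by exists M; split; rewrite ?num_real// => ? ? ? ?; exact: mrt.
Qed.

Lemma mu01 : (mu I01 < +oo)%E.
Proof. by rewrite measure_itvcc// ltry. Qed.

Lemma ucont01_integrable f : ucont01 f -> mu.-integrable I01 (EFin \o f).
Proof.
move=> cf; apply: measurable_bounded_integrable => //; first exact: mu01.
  exact: ucont01_measurable.
exact: ucont01_bounded.
Qed.

Lemma integrable01S (f : R -> \bar R) x y : 0 <= x -> y <= 1 ->
  mu.-integrable I01 f -> mu.-integrable `[x, y] f.
Proof.
move=> x0 y1; apply: integrableS => //.
move=> z /=; rewrite !in_itv/= => /andP[xz zy].
by rewrite (le_trans x0 xz) (le_trans zy y1).
Qed.

Lemma integrable_ucont01M c f : ucont01 c -> mu.-integrable I01 (EFin \o f) ->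
  mu.-integrable I01 (EFin \o (fun s => c s * f s)).
Proof.
move=> cc intf.
have := @integrableMr _ _ _ mu _ (measurable_itv _) _ _
  (ucont01_measurable cc) (ucont01_bounded cc) intf.
by apply: eq_integrable => // z _ /=; rewrite EFinM.
Qed.

(** An integrated chain rule [A' = c B']: the difference of [A] and the integral of [c * beta] has
    increments below [e] times those of the integral of [|beta|], hence is constant. The abstract
    form serves both the substitution and its inverse. *)
Lemma chain_rule01 (A B c beta : R -> R) :
  mu.-integrable I01 (EFin \o beta) ->
  (forall x y, 0 <= x -> x <= y -> y <= 1 -> B y - B x = Rintegral mu `[x, y] beta) ->
  ucont01 c ->
  (forall e, 0 < e -> exists2 r, 0 < r & forall x y, 0 <= x -> x <= y -> y <= 1 ->
    y - x < r -> `|A y - A x - c x * (B y - B x)| <= e * `|B y - B x|) ->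
  forall x y, 0 <= x -> x <= y -> y <= 1 ->
    A y - A x = Rintegral mu `[x, y] (fun s => c s * beta s).
Proof.
move=> ib BE cc AB.
have icb := integrable_ucont01M cc ib.
have inb := integrable_norm ib.
pose cb s := c s * beta s.
pose D x := A x - Rintegral mu `[0, x] cb.
pose W x := Rintegral mu `[0, x] (fun s => `|beta s|).
have split01 (f : R -> R) x y : 0 <= x -> x <= y -> y <= 1 ->
    mu.-integrable I01 (EFin \o f) ->
    Rintegral mu `[0, y] f - Rintegral mu `[0, x] f = Rintegral mu `[x, y] f.
  move=> x0 xy y1 intf; rewrite (Rintegral_itv_split x0 xy); first by rewrite addrC addKr.
  exact: integrable01S intf.
have DE : forall x y, 0 <= x -> x <= y -> y <= 1 -> D y = D x.
  apply: (@small_increments_const D W) => e e0.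
  have [r1 r10 H1] := cc _ (divr_gt0 e0 (ltr0Sn _ 1)).
  have [r2 r20 H2] := AB _ (divr_gt0 e0 (ltr0Sn _ 1)).
  exists (Order.min r1 r2); first by rewrite lt_min r10.
  move=> x y x0 xy y1; rewrite lt_min => /andP[h1 h2].
  have ibxy := integrable01S x0 y1 ib.
  have inbxy : mu.-integrable `[x, y] (EFin \o (fun s => `|beta s|)).
    exact: integrable01S inb.
  rewrite /W split01//.
  (* The error splits into the linearization error of [A] and the oscillation of [c] on [[x, y]],
     each given [e / 2]. *)
  have -> : D y - D x = (A y - A x - c x * (B y - B x))
     - Rintegral mu `[x, y] (fun s => (c s - c x) * beta s).
    rewrite (_ : Rintegral _ _ _ = Rintegral mu `[x, y] cb - c x * (B y - B x)).
      by rewrite -split01// /D; ring.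
    rewrite BE// -RintegralZl// -RintegralB//; last 2 first.
    - exact: integrable01S icb.
    - have := @integrableZl _ _ _ mu _ (measurable_itv _) (c x) _ ibxy.
      by apply: eq_integrable => // z _ /=; rewrite EFinM.
    by apply: eq_Rintegral => z _; rewrite /cb mulrBl.
  apply: (le_trans (ler_normB _ _)).
  have -> : e * Rintegral mu `[x, y] (fun s => `|beta s|) =
      e / 2 * Rintegral mu `[x, y] (fun s => `|beta s|)
      + e / 2 * Rintegral mu `[x, y] (fun s => `|beta s|) by field.
  apply: lerD.
    apply: (le_trans (H2 _ _ x0 xy y1 h2)); apply: ler_wpM2l; first lra.
    by rewrite BE//; exact: le_normr_Rintegral.
  have idc : mu.-integrable `[x, y] (EFin \o (fun s => (c s - c x) * beta s)).
    have := @integrableB _ _ _ mu _ (measurable_itv _) _ _ (integrable01S x0 y1 icb)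
      (@integrableZl _ _ _ mu _ (measurable_itv _) (c x) _ ibxy).
    by apply: eq_integrable => // z _ /=; rewrite mulrBl EFinB EFinM.
  apply: (le_trans (le_normr_Rintegral _ idc)) => //.
  rewrite -RintegralZl//; apply: le_Rintegral => //.
  - exact: integrable_norm.
  - have := @integrableZl _ _ _ mu _ (measurable_itv _) (e / 2) _ inbxy.
    by apply: eq_integrable => // z _ /=; rewrite EFinM.
  move=> s; rewrite /= in_itv/= => /andP[xs sy]; rewrite normrM ler_wpM2r//.
  by apply: H1 => //; lra.
move=> x y x0 xy y1; have := DE _ _ x0 xy y1; rewrite /D -split01//; lra.
Qed.

(** * Moduli of continuity of primitives of [L^p] functions *)

Section modulus.
Variables (p : R).
Hypothesis p1 : 1 < p.

Lemma Lp01_integrable f : Lp01 p f -> mu.-integrable I01 (EFin \o f).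
Proof.
move=> [mf lt]; apply: (powR_integrable (ltW p1)) => //; first exact: mu01.
exact: integrable_normr_powR.
Qed.

Lemma Lp01_powR_le f x y : Lp01 p f -> 0 <= x -> x <= y -> y <= 1 ->
  `|Rintegral mu `[x, y] f| `^ p <=
    (y - x) `^ (p - 1) * Rintegral mu I01 (fun s => `|f s| `^ p).
Proof.
move=> lf x0 xy y1; have [mf lt] := lf.
have ip := @integrable_normr_powR _ _ _ mu _ _ _ mf lt.
have ipxy := integrable01S x0 y1 ip.
have mxy : (mu `[x, y]%classic < +oo)%E by rewrite measure_itvcc// ltry.
have sub : `[x, y]%classic `<=` I01.
  move=> z /=; rewrite !in_itv/= => /andP[xz zy].
  by rewrite (le_trans x0 xz) (le_trans zy y1).
apply: (@le_trans _ _ ((Rintegral mu `[x, y] (fun s => `|f s|)) `^ p)).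
  apply: ge0_ler_powR; rewrite ?nnegrE//.
  - by apply: ltW; apply: lt_trans p1.
  - by apply: Rintegral_ge0.
  by apply: le_normr_Rintegral => //; exact: integrable01S (Lp01_integrable lf).
have := @Rintegral_powR_le _ _ _ mu _ _ _ p1 (measurable_itv _) mxy
  (measurable_funS (measurable_itv _) sub mf) ipxy.
move=> /le_trans; apply; rewrite /= measure_itvcc//= ler_wpM2l ?powR_ge0//.
rewrite -lee_fin /Rintegral !fineK; last 2 first.
- exact: (integrable_fin_num _ ip).
- exact: (integrable_fin_num _ ipxy).
apply: ge0_subset_integral => //.
- exact: (measurable_int _ ip).
Qed.

(** The radius depends on [f] only through the energy bound [C], which makes primitives of bounded
    energy equicontinuous. *)
Lemma Lp01_modulus (C e : R) : 0 <= C -> 0 < e -> exists2 r, 0 < r &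
  forall f x y, Lp01 p f -> Rintegral mu I01 (fun s => `|f s| `^ p) <= C ->
    0 <= x -> x <= y -> y <= 1 -> y - x < r -> `|Rintegral mu `[x, y] f| <= e.
Proof.
move=> C0 e0; have [r r0 H] := powR_modulus p1 C0 e0; exists r => // f x y lf fC x0 xy y1 yr.
apply: (H (y - x)) => //; first by rewrite subr_ge0 xy.
apply: (le_trans (Lp01_powR_le lf x0 xy y1)).
by rewrite ler_wpM2l// powR_ge0.
Qed.

Lemma Lp01_ucont f F : Lp01 p f ->
  (forall x y, 0 <= x -> x <= y -> y <= 1 -> F y - F x = Rintegral mu `[x, y] f) ->
  ucont01 F.
Proof.
move=> lf FE e e0.
have C0 : 0 <= Rintegral mu I01 (fun s => `|f s| `^ p).
  by apply: Rintegral_ge0 => s _; exact: powR_ge0.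
have [r r0 H] := Lp01_modulus C0 e0; exists r => // x y x0 xy y1 yr.
by rewrite FE//; exact: H.
Qed.

Lemma Lp01_ucontM c f : ucont01 c -> Lp01 p f -> Lp01 p (fun s => c s * f s).
Proof.
move=> cc [mf lt]; have mc := ucont01_measurable cc.
have mcf : measurable_fun I01 (fun s => c s * f s) by exact: measurable_funM.
split; first exact: mcf.
have [M [_ /(_ (`|M| + 1)) cM]] := ucont01_bounded cc.
have {}cM s : I01 s -> `|c s| <= `|M| + 1.
  by apply: cM; rewrite (le_lt_trans (ler_norm _))// ltrDl.
have ip := @integrable_normr_powR _ _ _ mu _ _ _ mf lt.
have := @integrableZl _ _ _ mu _ (measurable_itv _) ((`|M| + 1) `^ p) _ ip.
move=> /integrableP[mi] /le_lt_trans; apply; apply: ge0_le_integral => //.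
- exact/measurable_EFinP/measurable_fun_normr_powR.
- by apply: measurableT_comp.
- move=> x x01; rewrite /= lee_fin [leRHS]ger0_norm ?mulr_ge0 ?powR_ge0//.
  rewrite normrM powRM// ler_wpM2r ?powR_ge0//; apply: ge0_ler_powR.
  + by apply: ltW; apply: lt_trans p1.
  + by rewrite nnegrE.
  + by rewrite nnegrE addr_ge0.
  + exact: cM.
Qed.

End modulus.
End unit_interval.

(** * The slope transform *)

Section slope_transform.
Context {R : realType}.
Local Notation mu := (@lebesgue_measure R).
Variable p : R.
Hypothesis p1 : 1 < p.

(** The [p]-th root of the weight [(1 + t^2)^(1/2 - 3p/2)] carried by [|u''|^p] in the energy, and
    the integrand of [cp]. *)
Definition slope_weight (t : R) : R :=
  (1 + t ^+ 2) `^ (- (3%:R / 2%:R - 1 / (2 * p))).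
Local Notation q := slope_weight.

Let alpha : R := 3%:R / 2%:R - 1 / (2 * p).

Let alpha01 : 0 < alpha <= 3%:R / 2%:R.
Proof.
have p2 := p1.
have p0 : 0 < 2 * p by lra.
have h1 : 0 < 1 / (2 * p) by exact: divr_gt0.
have h2 : 1 / (2 * p) < 1 by rewrite ltr_pdivrMr//; lra.
by rewrite /alpha; apply/andP; split; lra.
Qed.

Let sq1 (t : R) : 1 <= 1 + t ^+ 2. Proof. by rewrite lerDl sqr_ge0. Qed.

Lemma slope_weight_gt0 t : 0 < q t.
Proof. by apply: powR_gt0; apply: lt_le_trans (sq1 t). Qed.

Lemma slope_weightN t : q (- t) = q t.
Proof. by rewrite /slope_weight sqrrN. Qed.

(** Mean value theorem: on [[1, +oo[] the derivative is at most [alpha <= 3/2] in absolute value. *)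
Let powR_lip (a b : R) : 1 <= a -> 1 <= b ->
  `|b `^ (- alpha) - a `^ (- alpha)| <= 3%:R / 2%:R * `|b - a|.
Proof.
wlog ab : a b / a < b.
  move=> H a1 b1; have [ab|ab|->] := ltgtP a b; first exact: H.
    by rewrite distrC (distrC b); exact: H.
  by rewrite !subrr normr0 mulr0.
move=> a1 b1; have /andP[al0 al1] := alpha01.
have [||c] := @MVT R (fun x => x `^ (- alpha)) (fun x => - alpha * x `^ (- alpha - 1)) a b ab.
- move=> x; rewrite in_itv/= => /andP[ax _].
  have x0 : x \in `]0, +oo[.
    by rewrite in_itv/= andbT (lt_trans _ ax)// (lt_le_trans _ a1).
  rewrite -(powR_derive1 _ x0) derive1E; apply: DeriveDef => //.
  exact: derivable_powR.
- apply: derivable_within_continuous => x; rewrite in_itv/= => /andP[ax _].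
  by apply: derivable_powR; rewrite in_itv/= andbT (lt_le_trans _ ax)// (lt_le_trans _ a1).
rewrite in_itv/= => /andP[ac _] ->.
have c1 : 1 < c by exact: le_lt_trans ac.
rewrite normrM ler_wpM2r// normrM normrN (ger0_norm (ltW al0)).
rewrite -[leRHS]mulr1; apply: ler_pM => //; first exact: ltW.
rewrite ger0_norm ?powR_ge0//.
have -> : - alpha - 1 = - (alpha + 1) by ring.
rewrite powRN invf_le1 ?powR_gt0//; last exact: lt_trans c1.
rewrite -[leLHS](powRr0 c); apply: ler_powR; first exact: ltW.
by rewrite addr_ge0// ltW.
Qed.

Lemma slope_weight_lip K s t : `|s| <= K -> `|t| <= K ->
  `|q t - q s| <= 3%:R * K * `|t - s|.
Proof.
move=> sK tK; apply: (le_trans (powR_lip (sq1 s) (sq1 t))).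
have -> : 1 + t ^+ 2 - (1 + s ^+ 2) = (t + s) * (t - s) by ring.
rewrite normrM mulrA ler_wpM2r//.
have := ler_normD t s; lra.
Qed.

Lemma slope_weight_anti K s : `|s| <= K -> q K <= q s.
Proof.
move=> sK; rewrite /slope_weight -/alpha !powRN lef_pV2 ?posrE.
- have /andP[al0 _] := alpha01; apply: ge0_ler_powR; rewrite ?nnegrE.
  + exact: ltW.
  + exact: le_trans (sq1 _).
  + exact: le_trans (sq1 _).
  + rewrite lerD2l -(real_normK (num_real s)) lerXn2r// nnegrE//.
    exact: le_trans sK.
- by apply: powR_gt0; apply: lt_le_trans (sq1 _).
- by apply: powR_gt0; apply: lt_le_trans (sq1 _).
Qed.

Lemma slope_weight_continuous : continuous q.
Proof.
move=> x; apply/cvgrPdist_le => e e0.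
pose K := `|x| + 1; have K0 : 0 < 3%:R * K by rewrite mulr_gt0// ltr_pwDr.
have r0 : 0 < Order.min 1 (e / (3%:R * K)) by rewrite lt_min ltr01 divr_gt0.
near=> y.
have : `|x - y| < Order.min 1 (e / (3%:R * K)).
  by near: y; apply/nbhs_normP; exists (Order.min 1 (e / (3%:R * K))).
rewrite lt_min => /andP[h1 h2].
have yK : `|y| <= K.
  rewrite /K; have := lerB_normD y (x - y); rewrite [y + _]addrC subrK; lra.
have xK : `|x| <= K by rewrite /K lerDl.
apply: (le_trans (slope_weight_lip yK xK)).
by rewrite mulrC -ler_pdivlMr// ltW.
Unshelve. all: by end_near. Qed.

Lemma slope_weight_integrable a b : mu.-integrable `[a, b] (EFin \o q).
Proof.
apply: continuous_compact_integrable; first exact: segment_compact.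
by apply: continuous_subspaceT; exact: slope_weight_continuous.
Qed.

(** Set integrals carry no orientation and [[a, b]] is empty for [b < a]; the difference is the
    oriented integral from [0] to [t]. *)
Definition slope_primitive (t : R) : R :=
  Rintegral mu `[0, t] q - Rintegral mu `[t, 0] q.
Local Notation G := slope_primitive.

Let int_pt (x : R) : Rintegral mu `[x, x] q = 0.
Proof. by rewrite set_itv1 Rintegral_set1. Qed.

Let int_rev (x y : R) : x < y -> Rintegral mu `[y, x] q = 0.
Proof. by move=> xy; rewrite set_itv_ge ?bnd_simp -?ltNge// Rintegral_set0. Qed.

Lemma slope_primitiveB x y : x <= y -> G y - G x = Rintegral mu `[x, y] q.
Proof.
move=> xy; rewrite /G.
have sp a b c : a <= b -> b <= c ->
    Rintegral mu `[a, c] q = Rintegral mu `[a, b] q + Rintegral mu `[b, c] q.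
  by move=> ab bc; apply: Rintegral_itv_split => //; exact: slope_weight_integrable.
have [x0|x0|x0] := ltgtP x 0; have [y0|y0|y0] := ltgtP y 0.
- rewrite (int_rev x0) (int_rev y0) (sp x y 0)// ?ltW//; ring.
- rewrite (int_rev x0) (int_rev y0) (sp x 0 y)// ?ltW//; ring.
- by rewrite y0 int_pt (int_rev x0); ring.
- lra.
- rewrite (int_rev x0) (int_rev y0) (sp 0 x y)// ?ltW//; ring.
- lra.
- lra.
- by rewrite x0 int_pt (int_rev y0); ring.
- by rewrite x0 y0 int_pt; ring.
Qed.

Lemma slope_primitive0 : G 0 = 0.
Proof. by rewrite /G subrr. Qed.

Lemma slope_primitiveN t : G (- t) = - G t.
Proof.
wlog t0 : t / 0 <= t.
  move=> H; have [/H//|/ltW t0] := leP 0 t.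
  by have := H (- t); rewrite oppr_ge0 opprK => /(_ t0) ->; rewrite opprK.
have := @slope_primitiveB (- t) 0; rewrite slope_primitive0 oppr_le0 => /(_ t0).
have := @slope_primitiveB 0 t t0; rewrite slope_primitive0 subr0 => ->.
suff -> : Rintegral mu `[- t, 0] q = Rintegral mu `[0, t] q by lra.
have cq : {within `[- t, - 0], continuous q}.
  by apply: continuous_subspaceT; exact: slope_weight_continuous.
have := integration_by_substitution_oppr t0 cq; rewrite oppr0 /Rintegral => ->.
by congr fine; apply: eq_integral => x _; exact/congr1/slope_weightN.
Qed.

(** Integrates the Lipschitz bound on [q] between [s] and [t]. The quadratic error provides the
    linearization that [chain_rule01] asks for. *)
Lemma slope_primitive_taylor K s t : `|s| <= K -> `|t| <= K ->
  `|G t - G s - q s * (t - s)| <= 3%:R * K * `|t - s| * `|t - s|.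
Proof.
move=> sK tK; have [st|/ltW ts] := leP s t.
  rewrite slope_primitiveB// [X in _ <= _ * X]ger0_norm ?subr_ge0//.
  apply: Rintegral_cst_approx => //; first exact: slope_weight_integrable.
  move=> u su ut; have uK : `|u| <= K.
    move: sK tK; rewrite !ler_norml => /andP[? ?] /andP[? ?]; apply/andP; split; lra.
  apply: (le_trans (slope_weight_lip sK uK)); rewrite ler_wpM2l//.
    by rewrite mulr_ge0// (le_trans _ sK).
  by rewrite !ger0_norm; lra.
have -> : G t - G s - q s * (t - s) = - (G s - G t - q s * (s - t)) by ring.
rewrite normrN (distrC t s) slope_primitiveB// [X in _ <= _ * X]ger0_norm ?subr_ge0//.
apply: Rintegral_cst_approx => //; first exact: slope_weight_integrable.
move=> u su ut; have uK : `|u| <= K.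
  move: sK tK; rewrite !ler_norml => /andP[? ?] /andP[? ?]; apply/andP; split; lra.
apply: (le_trans (slope_weight_lip sK uK)); rewrite ler_wpM2l//.
  by rewrite mulr_ge0// (le_trans _ sK).
by rewrite (distrC u) ger0_norm ?subr_ge0// ger0_norm ?subr_ge0//; lra.
Qed.

Lemma slope_primitive_ge K s t : s <= t -> `|s| <= K -> `|t| <= K ->
  q K * (t - s) <= G t - G s.
Proof.
move=> st sK tK; rewrite slope_primitiveB//.
have mst : (mu `[s, t]%classic < +oo)%E by rewrite measure_itvcc// ltry.
have -> : q K * (t - s) = Rintegral mu `[s, t] (cst (q K)).
  by rewrite Rintegral_cst//= measure_itvcc.
apply: le_Rintegral => //.
- by apply: measurable_bounded_integrable => //; exact: bounded_cst.
- exact: slope_weight_integrable.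
- move=> u; rewrite /= in_itv/= => /andP[su ut]; apply: slope_weight_anti.
  move: sK tK; rewrite !ler_norml => /andP[? ?] /andP[? ?]; apply/andP; split; lra.
Qed.

(** The derivative of [G] is at least [q K] on [[-K, K]], so control of [G \o g] transfers back to
    [g]. *)
Lemma slope_primitive_expand K s t : `|s| <= K -> `|t| <= K ->
  q K * `|t - s| <= `|G t - G s|.
Proof.
move=> sK tK; have [st|/ltW ts] := leP s t.
  rewrite ger0_norm ?subr_ge0//; apply: le_trans (ler_norm _).
  exact: slope_primitive_ge.
rewrite distrC (distrC (G t)) ger0_norm ?subr_ge0//; apply: le_trans (ler_norm _).
exact: slope_primitive_ge.
Qed.

(** [G] is odd and strictly increasing. *)
Lemma slope_primitive_le_norm K s : 0 <= K -> `|G s| <= G K -> `|s| <= K.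
Proof.
move=> K0.
have H t : 0 <= t -> G t <= G K -> t <= K.
  move=> t0 GtK; rewrite leNgt; apply/negP => Kt.
  have := @slope_primitive_ge t K t (ltW Kt).
  rewrite !ger0_norm// => /(_ (ltW Kt) (lexx _)).
  have : 0 < q t * (t - K) by rewrite mulr_gt0 ?slope_weight_gt0 ?subr_gt0.
  lra.
move=> GsK; have [s0|s0] := leP 0 s.
  by rewrite ger0_norm//; apply: H => //; apply: le_trans GsK; exact: ler_norm.
rewrite ltr0_norm//; apply: H; first by rewrite oppr_ge0 ltW.
by rewrite slope_primitiveN; apply: le_trans GsK; rewrite -normrN ler_norm.
Qed.

(** By monotone convergence over the intervals [[0, n]], [2 G n] tends to [cp p]. *)
Lemma cp_lt_slope_primitive c : 0 <= c -> c < cp p ->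
  exists2 K, 0 <= K & c < 2 * G K.
Proof.
move=> c0; rewrite /cp; set I := (X in fine X).
have I0 : (0 <= I)%E by apply: integral_ge0 => x _; rewrite lee_fin powR_ge0.
(* [fine +oo] is [0], so an infinite integral would make [cp p] zero, against [0 <= c < cp p]. *)
have [Iy|Iy] := eqVneq I +oo%E; first by rewrite Iy/= mulr0; lra.
have Ifin : I \is a fin_num by rewrite ge0_fin_numE// ltey.
move=> cI; pose F (n : nat) := `[(0 : R)%R, (n%:R : R)]%classic.
have UF : \bigcup_n F n = `[(0 : R)%R, +oo[%classic.
  apply/seteqP; split => x /=.
    by move=> [n _]; rewrite /F/= !in_itv/= => /andP[->].
  rewrite in_itv/= andbT => x0; exists (Num.truncn x).+1 => //.
  by rewrite /F/= in_itv/= x0/= ltW// truncnS_gt.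
have cv : (\int[mu]_(x in F n) (q x)%:E)%E @[n --> \oo] --> I.
  rewrite /I -UF; apply: ge0_nondecreasing_set_cvg_integral.
  - move=> m n mn; apply/subsetPset => x; rewrite /F/= !in_itv/= => /andP[->/=] xm.
    by rewrite (le_trans xm)// ler_nat.
  - by move=> i; exact: measurable_itv.
  - by move=> i; exact: (measurable_int _ (slope_weight_integrable _ _)).
  - by move=> i x _; rewrite lee_fin powR_ge0.
move: cv; rewrite -(fineK Ifin) => /fine_cvgP[_] /cvgrPdist_lt.
have e0 : 0 < fine I - c / 2 by lra.
move=> /(_ _ e0)[n _ /(_ n (leqnn _)) h]; exists n%:R => //.
have JE := @slope_primitiveB 0 n%:R (ler0n _ _).
rewrite slope_primitive0 subr0 in JE.
have {}h : `|fine I - G n%:R| < fine I - c / 2 by rewrite JE; exact: h.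
move: (G _) (fine I) h => J f h; have := ler_norm (f - J); lra.
Qed.

End slope_transform.

(** * Absolutely continuous functions, their derivatives and symmetry *)

Section primitives.
Context {R : realType}.
Local Notation mu := (@lebesgue_measure R).
Local Notation I01 := (`[(0 : R)%R, (1 : R)%R]%classic).
Implicit Types (v g w : R -> R).

(** Absolute continuity with density [g]; the increment form refers to no base point and matches the
    hypotheses of [chain_rule01]. *)
Definition primitive01 g v := forall x y, 0 <= x -> x <= y -> y <= 1 ->
  v y - v x = Rintegral mu `[x, y] g.

Lemma primitive01P g v : mu.-integrable I01 (EFin \o g) ->
  (forall x, 0 <= x <= 1 -> v x = v 0 + Rintegral mu `[0, x] g) ->
  primitive01 g v.
Proof.
move=> ig vE x y x0 xy y1; have y0 := le_trans x0 xy.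
rewrite (vE y) ?y0// (vE x) ?x0 ?(le_trans xy)//.
rewrite (Rintegral_itv_split x0 xy); first ring.
exact: integrable01S ig.
Qed.

Lemma primitive01_cst_approx g v c e x y : primitive01 g v -> ucont01 g ->
  0 <= x -> x <= y -> y <= 1 ->
  (forall s, x <= s -> s <= y -> `|g s - c| <= e) ->
  `|v y - v x - c * (y - x)| <= e * (y - x).
Proof.
move=> gv cg x0 xy y1 H; rewrite gv//; apply: Rintegral_cst_approx => //.
exact: integrable01S (ucont01_integrable cg).
Qed.

(** Restricted to interior points, since at an end point [derive1] would see values of [v] outside
    [[0, 1]]. *)
Lemma primitive01_derive1 g v x : primitive01 g v -> ucont01 g ->
  0 < x < 1 -> derive1 v x = g x.
Proof.
move=> gv cg /andP[x0 x1]; apply: cvg_lim => //.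
apply/cvgrPdist_le => e e0; have [r r0 H] := ucont01_sym cg e0.
near=> h.
have h0 : h != 0 by near: h; exact: nbhs_dnbhs_neq.
have hr : `|h| < r by near: h; exact: dnbhs0_lt.
have hx : `|h| < x by near: h; exact: dnbhs0_lt.
have hx1 : `|h| < 1 - x by near: h; apply: dnbhs0_lt; rewrite subr_gt0.
have -> : g x - h^-1 *: (v (h + x) - v x) = - (h^-1 * (v (h + x) - v x - g x * h)).
  by rewrite /GRing.scale/=; field.
rewrite normrN normrM normfV mulrC ler_pdivrMr ?normr_gt0//.
move: hr hx hx1; rewrite !ltr_norml => /andP[hr1 hr2] /andP[hx _] /andP[_ hx1].
have [hp|hn] := leP 0 h.
  rewrite [X in _ <= _ * X]ger0_norm//.
  have := @primitive01_cst_approx g v (g x) e x (h + x) gv cg.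
  have -> : h + x - x = h by ring.
  apply; [lra|lra|lra|].
  move=> s xs sy; apply: H; [lra|lra|].
  by rewrite ltr_norml; lra.
rewrite [X in _ <= _ * X]ltr0_norm//.
have := @primitive01_cst_approx g v (g x) e (h + x) x gv cg.
have -> : x - (h + x) = - h by ring.
have -> : v (h + x) - v x - g x * h = - (v x - v (h + x) - g x * - h) by ring.
rewrite normrN; apply; [lra|lra|lra|].
move=> s xs sy; apply: H; [lra|lra|].
by rewrite ltr_norml; lra.
Unshelve. all: by end_near. Qed.

(** Compares the increments over [[z, y]] and [[1 - y, 1 - z]], which symmetry makes opposite.
    Increments, unlike [derive1], also reach the end points. *)
Lemma primitive01_antisym g v x : primitive01 g v -> ucont01 g ->
  (forall x, 0 <= x <= 1 -> v x = v (1 - x)) ->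
  0 <= x <= 1 -> g (1 - x) = - g x.
Proof.
move=> gv cg vsym.
have H z : 0 <= z < 1 -> g (1 - z) = - g z.
  move=> /andP[z0 z1]; apply/eqP; rewrite -subr_eq0 opprK -normr_le0.
  apply/ler_addgt0Pr => e e0; rewrite add0r.
  have [r r0 {}H] := ucont01_sym cg (divr_gt0 e0 (ltr0Sn _ 1)).
  (* The halves keep [y] at most [1] and strictly within [r] of [z]. *)
  pose y := z + Order.min ((1 - z) / 2) (r / 2).
  have ymin : Order.min ((1 - z) / 2) (r / 2) <= (1 - z) / 2 by rewrite ge_min lexx.
  have ymin' : Order.min ((1 - z) / 2) (r / 2) <= r / 2 by rewrite ge_min lexx orbT.
  have ym0 : 0 < Order.min ((1 - z) / 2) (r / 2) by rewrite lt_min; apply/andP; split; lra.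
  have zy : z < y by rewrite /y; lra.
  have y1 : y <= 1 by rewrite /y; lra.
  have yr : y - z < r by rewrite /y; lra.
  have A1 : `|v y - v z - g z * (y - z)| <= e / 2 * (y - z).
    apply: (primitive01_cst_approx gv cg) => //; first exact: ltW.
    move=> s zs sy; apply: H; [lra|lra|].
    by rewrite ltr_norml; lra.
  have A2 : `|v (1 - z) - v (1 - y) - g (1 - z) * ((1 - z) - (1 - y))|
     <= e / 2 * ((1 - z) - (1 - y)).
    apply: (primitive01_cst_approx gv cg); [lra|lra|lra|].
    move=> s zs sy; apply: H; [lra|lra|].
    by rewrite ltr_norml; lra.
  move: A2; rewrite -(vsym z); last lra.
  rewrite -(vsym y); last lra.
  have -> : 1 - z - (1 - y) = y - z by ring.
  move=> A2; have yz0 : 0 < y - z by lra.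
  rewrite -(ler_pM2r yz0) -[X in _ * X <= _](gtr0_norm yz0) -normrM.
  have -> : (g (1 - z) + g z) * (y - z) =
    - (v y - v z - g z * (y - z)) - (v z - v y - g (1 - z) * (y - z)) by ring.
  apply: (le_trans (ler_normB _ _)); rewrite normrN; lra.
(* There is no room to the right of [x = 1]; that case is the reflection of [z = 0]. *)
move=> /andP[x0 x1]; have [xl|xg] := ltP x 1; first by apply: H; rewrite x0.
have -> : x = 1 by apply/eqP; rewrite eq_le x1 xg.
rewrite subrr; have := H 0; rewrite subr0 lexx ltr01 => /(_ isT) ->.
by rewrite opprK.
Qed.

End primitives.

(** * The energy in terms of the transformed slope *)

Section energy.
Context {R : realType}.
Local Notation mu := (@lebesgue_measure R).
Local Notation I01 := (`[(0 : R)%R, (1 : R)%R]%classic).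
Variable p : R.
Hypothesis p1 : 1 < p.
Implicit Types (v g w : R -> R).
Local Notation q := (@slope_weight R p).
Local Notation G := (@slope_primitive R p).

Let p0 : 0 < p. Proof. exact: lt_trans p1. Qed.

(** Collects the powers of [1 + b^2]: [-3p/2 + 1/2 = -p (3/2 - 1/(2p))]. *)
Lemma curvature_energy_density (a b : R) :
  (`|a / (1 + b ^+ 2) `^ (3%:R / 2%:R)| `^ p) * Num.sqrt (1 + b ^+ 2) =
  `|q b * a| `^ p.
Proof.
have c1 : 1 <= 1 + b ^+ 2 by rewrite lerDl sqr_ge0.
have c0 : 0 < 1 + b ^+ 2 by apply: lt_le_trans c1.
have cn0 : 1 + b ^+ 2 != 0 by rewrite gt_eqF.
rewrite /slope_weight -powR12_sqrt ?ltW//.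
set c := 1 + b ^+ 2 in c1 c0 cn0 *.
rewrite -powRN [_ * a]mulrC !normrM !(ger0_norm (powR_ge0 _ _)).
rewrite !powRM ?powR_ge0// -!powRrM -mulrA -powRD ?cn0 ?implybT//.
congr (_ * _ `^ _); field; by rewrite gt_eqF.
Qed.

Lemma slope_weight_ucont g : ucont01 g -> ucont01 (q \o g).
Proof.
move=> cg e e0; have [M [_ /(_ (`|M| + 1)) gM]] := ucont01_bounded cg.
have {}gM s : 0 <= s <= 1 -> `|g s| <= `|M| + 1.
  move=> s01; apply: gM; last by rewrite /= in_itv.
  by rewrite (le_lt_trans (ler_norm _))// ltrDl.
have L0 : 0 < 3%:R * (`|M| + 1) by rewrite mulr_gt0// ltr_pwDr.
have [r r0 H] := cg _ (divr_gt0 e0 L0); exists r => // x y x0 xy y1 yr.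
apply: (le_trans (slope_weight_lip p1 (gM x _) (gM y _)));
  rewrite ?x0 ?y1 ?(le_trans x0) ?(le_trans xy)//.
by rewrite mulrC -ler_pdivlMr//; exact: H.
Qed.

(** [chain_rule01] with [A = G \o g] and [B = g]: the Taylor remainder is quadratic in the increment
    of [g], and uniform continuity of [g] makes one of its factors small. *)
Lemma slope_primitive_chain g w : Lp01 p w -> primitive01 w g ->
  primitive01 (fun s => q (g s) * w s) (G \o g).
Proof.
move=> lw wg; have cg := Lp01_ucont p1 lw wg.
have [M [_ /(_ (`|M| + 1)) gM]] := ucont01_bounded cg.
have {}gM s : 0 <= s <= 1 -> `|g s| <= `|M| + 1.
  move=> s01; apply: gM; last by rewrite /= in_itv.
  by rewrite (le_lt_trans (ler_norm _))// ltrDl.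
have L0 : 0 < 3%:R * (`|M| + 1) by rewrite mulr_gt0// ltr_pwDr.
apply: (chain_rule01 (Lp01_integrable p1 lw) wg (slope_weight_ucont cg)) => e e0.
have [r r0 H] := cg _ (divr_gt0 e0 L0); exists r => // x y x0 xy y1 yr.
apply: (le_trans (slope_primitive_taylor p1 (gM x _) (gM y _)));
  rewrite ?x0 ?y1 ?(le_trans x0) ?(le_trans xy)//.
apply: ler_wpM2r => //.
by rewrite mulrC -ler_pdivlMr//; exact: H.
Qed.

Lemma slope_weightV_ucont g K : ucont01 g ->
  (forall x, 0 <= x <= 1 -> `|g x| <= K) -> ucont01 (fun x => (q (g x))^-1).
Proof.
move=> cg gK e e0.
have q0 x : 0 < q x by exact: slope_weight_gt0.
have qg x : 0 <= x <= 1 -> q K <= q (g x).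
  by move=> x01; apply: slope_weight_anti => //; exact: gK.
(* Both denominators, [q (g x)] and [q (g y)], are at least [q K]. *)
have e0' : 0 < e * (q K * q K) by rewrite !mulr_gt0.
have [r r0 H] := slope_weight_ucont cg e0'; exists r => // x y x0 xy y1 yr.
have x01 : 0 <= x <= 1 by rewrite x0 (le_trans xy).
have y01 : 0 <= y <= 1 by rewrite y1 (le_trans x0).
have -> : (q (g y))^-1 - (q (g x))^-1 = (q (g x) - q (g y)) / (q (g x) * q (g y)).
  by field; rewrite !gt_eqF.
rewrite normrM distrC normfV [X in _ / X]ger0_norm; last by rewrite mulr_ge0// ltW.
rewrite ler_pdivrMr; last by rewrite mulr_gt0.
apply: (le_trans (H _ _ x0 xy y1 yr)).
apply: ler_wpM2l; first exact: ltW.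
by apply: ler_pM; rewrite ?(ltW (q0 _))// qg.
Qed.

(** The inverse substitution: [chain_rule01] with [A] and [B] exchanged. The bound [K] on the slope
    keeps [q (g s)] above [q K], so its reciprocal is uniformly continuous. *)
Lemma slope_primitive_chainV g om K : Lp01 p om -> ucont01 g ->
  (forall x, 0 <= x <= 1 -> `|g x| <= K) ->
  primitive01 om (G \o g) -> primitive01 (fun s => (q (g s))^-1 * om s) g.
Proof.
move=> lom cg gK omg.
have K0 : 0 <= K by apply: le_trans (gK 0 _); rewrite ?lexx ?ler01.
have qg x : 0 <= x <= 1 -> q K <= q (g x).
  by move=> x01; apply: slope_weight_anti => //; exact: gK.
have q0 x : 0 < q x by exact: slope_weight_gt0.
apply: (chain_rule01 (Lp01_integrable p1 lom) omg (slope_weightV_ucont cg gK)) => e e0.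
have L0 : 0 < 3%:R * K + 1 by rewrite ltr_pwDr// mulr_ge0.
(* One factor [q K] bounds the increment of [g] by that of [G \o g], the other absorbs the division
   by [q (g x)]; the added [1] covers [K = 0]. *)
have e0' : 0 < e * (q K * q K) / (3%:R * K + 1) by rewrite divr_gt0// !mulr_gt0.
have [r r0 H] := cg _ e0'; exists r => // x y x0 xy y1 yr.
have x01 : 0 <= x <= 1 by rewrite x0 (le_trans xy).
have y01 : 0 <= y <= 1 by rewrite y1 (le_trans x0).
have T := slope_primitive_taylor p1 (gK _ x01) (gK _ y01).
have E := slope_primitive_expand p1 (gK _ x01) (gK _ y01).
have {}H := H _ _ x0 xy y1 yr.
have -> : g y - g x - (q (g x))^-1 * ((G \o g) y - (G \o g) x) =
  - ((q (g x))^-1 * (G (g y) - G (g x) - q (g x) * (g y - g x))).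
  by rewrite /=; field; rewrite gt_eqF.
rewrite normrN normrM normfV (gtr0_norm (q0 _)) mulrC ler_pdivrMr//.
apply: (le_trans T).
apply: (@le_trans _ _ (e * (q K * q K) * `|g y - g x|)).
  apply: ler_wpM2r => //.
  have : (3%:R * K + 1) * `|g y - g x| <= e * (q K * q K).
    by rewrite mulrC -ler_pdivlMr.
  have := normr_ge0 (g y - g x); lra.
have F : q K * (q K * `|g y - g x|) <= q (g x) * `|G (g y) - G (g x)|.
  by apply: ler_pM => //; [exact: ltW|rewrite mulr_ge0// ltW|exact: qg].
have := ler_wpM2l (ltW e0) F; rewrite /=; lra.
Qed.

End energy.

(** * Minimization *)

Section curves.
Context {R : realType}.
Local Notation mu := (@lebesgue_measure R).
Local Notation I01 := (`[(0 : R)%R, (1 : R)%R]%classic).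
Variable p : R.
Hypothesis p1 : 1 < p.
Implicit Types (v g w : R -> R).
Local Notation q := (@slope_weight R p).
Local Notation G := (@slope_primitive R p).

Let p0 : 0 < p. Proof. exact: lt_trans p1. Qed.

Lemma W2p_with_slope v w : W2p_with p v w -> Lp01 p w /\
  exists g, [/\ primitive01 w g, ucont01 g & primitive01 g v].
Proof.
move=> [lw [b vE]]; split=> //.
pose g s := b + Rintegral mu `[0, s] w.
have wg : primitive01 w g.
  apply: primitive01P; first exact: Lp01_integrable lw.
  by move=> x _; rewrite /g set_itv1 Rintegral_set1 addr0.
have cg := Lp01_ucont p1 lw wg.
exists g; split => //.
by apply: primitive01P => //; exact: ucont01_integrable.
Qed.

Lemma slope_W2p_with v g w : Lp01 p w -> primitive01 w g -> primitive01 g v ->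
  W2p_with p v w.
Proof.
move=> lw wg gv; split=> //; exists (g 0) => x /andP[x0 x1].
have := gv 0 x (lexx _) x0 x1 => /eqP; rewrite subr_eq addrC => /eqP ->.
congr (_ + _); apply: eq_Rintegral => s; rewrite inE/= in_itv/= => /andP[s0 sx].
by rewrite -wg// ?(le_trans sx)// addrC subrK.
Qed.

(** [derive1 v] is known to equal [g] on the open interval, and the two end points are negligible
    for the integral. *)
Lemma Ep_slope v g w : Lp01 p w -> ucont01 g -> primitive01 g v ->
  Ep p v w = (\int[mu]_(x in I01) (`|q (g x) * w x| `^ p)%:E)%E.
Proof.
move=> lw cg gv; have [mqw _] := Lp01_ucontM p1 (slope_weight_ucont p1 cg) lw.
have mR : measurable_fun `](0 : R)%R, (1 : R)%R[ (fun x => `|q (g x) * w x| `^ p).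
  apply: measurable_fun_normr_powR; apply: measurable_funS mqw => //.
  exact: subset_itv_oo_cc.
have E : {in `](0 : R)%R, (1 : R)%R[,
    (fun x => `|curv v w x| `^ p * Num.sqrt (1 + derive1 v x ^+ 2))
    =1 (fun x => `|q (g x) * w x| `^ p)}.
  move=> x; rewrite in_itv/= => x01.
  by rewrite /curv (primitive01_derive1 gv cg x01) curvature_energy_density.
apply: eq_integral_itv_bounded => //.
apply: eq_measurable_fun mR => x; rewrite inE/= => x01; exact/esym/E.
Qed.

(** Antisymmetry turns the increment of [G \o g] over [[z, 1 - z]] into [- 2 G (g z)]; the interval
    has length at most [1], so the length factor in Hoelder's inequality is at most [1]. *)
Lemma slope_primitive_bound g om x : Lp01 p om -> primitive01 om (G \o g) ->
  (forall x, 0 <= x <= 1 -> g (1 - x) = - g x) -> 0 <= x <= 1 ->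
  (2 * `|G (g x)|) `^ p <= Rintegral mu I01 (fun s => `|om s| `^ p).
Proof.
move=> lom omg anti.
set E := Rintegral _ _ _.
have E0 : 0 <= E by apply: Rintegral_ge0 => s _; exact: powR_ge0.
have H z : 0 <= z -> z <= 1 / 2 -> (2 * `|G (g z)|) `^ p <= E.
  move=> z0 z1.
  have z01 : 0 <= z <= 1 by apply/andP; split; lra.
  have z1' : 1 - z <= 1 by lra.
  have zz : z <= 1 - z by lra.
  have := Lp01_powR_le p1 lom z0 zz z1'.
  rewrite -omg//= anti// slope_primitiveN//.
  have -> : - G (g z) - G (g z) = - (2 * G (g z)) by ring.
  rewrite normrN normrM (ger0_norm (ler0n _ 2)) => /le_trans; apply.
  rewrite -/E -[leRHS]mul1r; apply: ler_wpM2r => //.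
  rewrite -[leRHS](powRr0 (1 - z - z)).
  (* At [z = 1/2] the interval is a point and the factor is [0^(p-1) = 0]. *)
  have [->|zn] := eqVneq (1 - z - z) 0.
    by rewrite powR0 ?powR_ge0// subr_eq0 gt_eqF.
  apply: ger_powR; last by rewrite subr_ge0 ltW.
  by rewrite lt_neqAle eq_sym zn/=; apply/andP; split; lra.
move=> /andP[x0 x1]; have [xl|/ltW xg] := leP x (1 / 2); first exact: H.
have := H (1 - x); rewrite anti ?x0// slope_primitiveN// normrN; apply; lra.
Qed.

End curves.

(** * Limits of curves with bounded slope and energy *)

Section compactness.
Context {R : realType}.
Local Notation mu := (@lebesgue_measure R).
Local Notation I01 := (`[(0 : R)%R, (1 : R)%R]%classic).
Variables (p C K m : R) (vn gn omn : nat -> R -> R).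
Local Notation q := (@slope_weight R p).
Local Notation G := (@slope_primitive R p).
Hypothesis p1 : 1 < p.
Hypothesis gvn : forall n, primitive01 (gn n) (vn n).
Hypothesis cgn : forall n, ucont01 (gn n).
Hypothesis lomn : forall n, Lp01 p (omn n).
Hypothesis omgn : forall n, primitive01 (omn n) (G \o gn n).
Hypothesis gnK : forall n x, 0 <= x <= 1 -> `|gn n x| <= K.
Hypothesis vn0 : forall n, vn n 0 = 0.
Hypothesis enC : forall n, Rintegral mu I01 (fun s => `|omn n s| `^ p) <= C.
Hypothesis enm : forall e, 0 < e ->
  \forall n \near \oo, Rintegral mu I01 (fun s => `|omn n s| `^ p) <= m + e.

(** The sequence enters through its slopes [gn] and the derivatives [omn] of [G \o gn]: the energy
    controls the latter in [L^p] and is convex in them. *)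
Lemma slope_compactness : exists (U : set_system nat) (u w : R -> R),
  [/\ UltraFilter U, (forall x, 0 <= x <= 1 -> vn n x @[n --> U] --> u x),
      W2p_with p u w & (Ep p u w <= m%:E)%E].
Proof.
(* [U] refines the filter of neighbourhoods of infinity, so [enm] holds along [U]; one [U] provides
   the limits at all points at once. *)
have [U [UU subU]] := ultraFilterLemma (@eventually_filter).
have UP : ProperFilter U by exact: ultra_proper.
have K0 : 0 <= K by apply: le_trans (gnK 0 (x := 0) _); rewrite ?lexx ?ler01.
have C0 : 0 <= C.
  by apply: le_trans (enC 0); apply: Rintegral_ge0 => s _; exact: powR_ge0.
have qK0 : 0 < q K by exact: slope_weight_gt0.
pose u x := lim (vn n x @[n --> U]); pose g x := lim (gn n x @[n --> U]).
have ucv x : 0 <= x <= 1 -> vn n x @[n --> U] --> u x.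
  move=> /andP[x0 x1]; apply: (@ultra_bounded_cvg _ _ _ K UU) => n.
  have := @primitive01_cst_approx _ (gn n) (vn n) 0 K 0 x (gvn n) (cgn n) (lexx _) x0 x1.
  rewrite vn0 mul0r !subr0 => H.
  apply: (@le_trans _ _ (K * x)); last by rewrite ler_piMr.
  by apply: H => s s0 sx; rewrite subr0; apply: gnK; rewrite s0 (le_trans sx).
have gcv x : 0 <= x <= 1 -> gn n x @[n --> U] --> g x.
  by move=> x01; apply: (@ultra_bounded_cvg _ _ _ K UU) => n; exact: gnK.
have gK x : 0 <= x <= 1 -> `|g x| <= K.
  move=> x01; apply: (cvgr_to_le (cvg_norm (gcv _ x01))).
  by apply: nearW => n; exact: gnK.
(* Increments of [G \o gn n] are integrals of [omn n], with a common modulus; they are at least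
   [q K] times those of [gn n], so the slopes are equicontinuous. *)
have equi e : 0 < e -> exists2 r, 0 < r & forall n x y,
    0 <= x -> x <= y -> y <= 1 -> y - x < r -> `|gn n y - gn n x| <= e.
  move=> e0; have [r r0 H] := Lp01_modulus p1 C0 (mulr_gt0 qK0 e0).
  exists r => // n x y x0 xy y1 yr.
  have x01 : 0 <= x <= 1 by rewrite x0 (le_trans xy).
  have y01 : 0 <= y <= 1 by rewrite y1 (le_trans x0).
  have := slope_primitive_expand p1 (gnK n x01) (gnK n y01).
  have := H _ _ _ (lomn n) (enC n) x0 xy y1 yr; rewrite -(omgn n)//= => h1 h2.
  by rewrite -(ler_pM2l qK0); exact: le_trans h1.
have cg : ucont01 g.
  move=> e e0; have [r r0 H] := equi _ e0; exists r => // x y x0 xy y1 yr.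
  have x01 : 0 <= x <= 1 by rewrite x0 (le_trans xy).
  have y01 : 0 <= y <= 1 by rewrite y1 (le_trans x0).
  apply: (cvgr_to_le (cvg_norm (cvgB (gcv _ y01) (gcv _ x01)))).
  by apply: nearW => n; exact: H.
have ig := ucont01_integrable cg.
(* Both [u] and the integral of [g] have increment [g x * (y - x)] up to [e / 2 * (y - x)], so their
   difference is constant. This replaces an exchange of limit and integral. *)
have gu : primitive01 g u.
  pose D x := u x - Rintegral mu `[0, x] g.
  have split01 x y : 0 <= x -> x <= y -> y <= 1 ->
      Rintegral mu `[0, y] g = Rintegral mu `[0, x] g + Rintegral mu `[x, y] g.
    move=> x0 xy y1; apply: Rintegral_itv_split => //; exact: integrable01S ig.
  have DE : forall x y, 0 <= x -> x <= y -> y <= 1 -> D y = D x.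
    apply: (@small_increments_const _ D id) => e e0.
    have e2 : 0 < e / 2 by lra.
    have [r1 r10 H1] := cg _ e2; have [r2 r20 H2] := equi _ e2.
    exists (Order.min r1 r2); first by rewrite lt_min r10.
    move=> x y x0 xy y1; rewrite lt_min => /andP[h1 h2].
    have x01 : 0 <= x <= 1 by rewrite x0 (le_trans xy).
    have y01 : 0 <= y <= 1 by rewrite y1 (le_trans x0).
    have A1 : `|Rintegral mu `[x, y] g - g x * (y - x)| <= e / 2 * (y - x).
      apply: Rintegral_cst_approx => //; first exact: integrable01S ig.
      by move=> s xs sy; apply: H1 => //; lra.
    have A2 : `|u y - u x - g x * (y - x)| <= e / 2 * (y - x).
      have c1 : vn n y - vn n x - gn n x * (y - x) @[n --> U]
          --> u y - u x - g x * (y - x).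
        apply: cvgB; first by apply: cvgB; exact: ucv.
        by apply: cvgM; [exact: gcv|exact: cvg_cst].
      apply: (cvgr_to_le (cvg_norm c1)); apply: nearW => n /=.
      apply: (primitive01_cst_approx (gvn n) (cgn n)) => //.
      by move=> s xs sy; apply: H2 => //; lra.
    have -> : D y - D x = (u y - u x - g x * (y - x)) -
       (Rintegral mu `[x, y] g - g x * (y - x)) by rewrite /D (split01 x y)//; ring.
    apply: (le_trans (ler_normB _ _)); rewrite /=; lra.
  move=> x y x0 xy y1; have := DE _ _ x0 xy y1; rewrite /D (split01 x y)//; lra.
have Gcv x : 0 <= x <= 1 -> G (gn n x) @[n --> U] --> G (g x).
  (* [B] is a Lipschitz constant for [G] around [g x]: in the quadratic Taylor error one factor is
     bounded by [2 * K]. *)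
  move=> x01; pose B := q (g x) + 3%:R * K * (2 * K).
  have B0 : 0 < B.
    by rewrite /B ltr_pwDl// ?slope_weight_gt0// !mulr_ge0.
  apply/cvgrPdist_le => e e0.
  have /cvgrPdist_le/(_ _ (divr_gt0 e0 B0)) := gcv _ x01.
  apply: filterS => n; rewrite distrC (distrC (G _)) => h.
  have T := slope_primitive_taylor p1 (gK _ x01) (gnK n x01).
  have d2K : `|gn n x - g x| <= 2 * K.
    by apply: (le_trans (ler_normB _ _)); have := gK _ x01; have := gnK n x01; lra.
  apply: (@le_trans _ _ (B * `|gn n x - g x|)); last by rewrite mulrC -ler_pdivlMr.
  have -> : G (gn n x) - G (g x) = (G (gn n x) - G (g x) - q (g x) * (gn n x - g x))
     + q (g x) * (gn n x - g x) by ring.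
  apply: (le_trans (ler_normD _ _)).
  rewrite [X in _ + X]normrM (gtr0_norm (slope_weight_gt0 _ _)) /B mulrDl addrC lerD2l.
  apply: (le_trans T); apply: ler_wpM2r => //.
  by apply: ler_wpM2l => //; rewrite mulr_ge0.
have iomn n : mu.-integrable I01 (EFin \o (fun x => `|omn n x| `^ p)).
  by have [mo lo] := lomn n; exact: integrable_normr_powR.
have momn n : measurable_fun I01 (omn n) by have [] := lomn n.
have [om [mom iom omcv]] := @weak_limit_density _ _ _ mu I01 p C U omn
   (measurable_itv _) mu01 p1 UU momn iomn enC.
(* Testing the weak convergence on intervals identifies [om] as the derivative of [G \o g]. *)
have omg : primitive01 om (G \o g).
  move=> x y x0 xy y1.
  have x01 : 0 <= x <= 1 by rewrite x0 (le_trans xy).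
  have y01 : 0 <= y <= 1 by rewrite y1 (le_trans x0).
  have sub : `[x, y]%classic `<=` I01.
    move=> z /=; rewrite !in_itv/= => /andP[xz zy].
    by rewrite (le_trans x0 xz) (le_trans zy y1).
  have c1 := omcv _ (measurable_itv `[x, y]) sub.
  have c2 : G (gn n y) - G (gn n x) @[n --> U] --> G (g y) - G (g x).
    by apply: cvgB; exact: Gcv.
  rewrite -(cvg_lim (@Rhausdorff R) c1); apply/esym/cvg_lim => //.
  have -> : (fun n => Rintegral mu `[x, y] (omn n)) = (fun n => G (gn n y) - G (gn n x)).
    by apply/funext => n; rewrite -(omgn n).
  exact: c2.
have elim_cv : cvg (Rintegral mu I01 (fun s => `|omn n s| `^ p) @[n --> U]).
  apply: (@ultra_bounded_cvg _ _ _ C UU) => n; rewrite ger0_norm//.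
  by apply: Rintegral_ge0 => s _; exact: powR_ge0.
have omle : (\int[mu]_(x in I01) (`|om x| `^ p)%:E <= m%:E)%E.
  apply: (le_trans (@weak_limit_powR_le _ _ _ mu I01 p C U omn
   (measurable_itv _) mu01 p1 UU momn iomn enC om _ mom iom omcv elim_cv)).
  (* Along [U] the energies are eventually at most [m + e], so their limit is at most [m]. *)
  rewrite lee_fin; apply/ler_addgt0Pr => e e0.
  by apply: (cvgr_to_le elim_cv); apply: subU; exact: enm.
have lom : Lp01 p om by split => //; apply: (le_lt_trans omle); rewrite ltry.
(* Division by [q (g s)] undoes the substitution: [q (g s) * w s = om s], so the energy of [u] is
   the integral of [|om|^p]. *)
pose w s := (q (g s))^-1 * om s.
have lw : Lp01 p w by exact: (Lp01_ucontM p1 (slope_weightV_ucont p1 cg gK)).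
have wg : primitive01 w g by exact: (slope_primitive_chainV p1 lom cg gK).
exists U, u, w; split => //; first exact: slope_W2p_with gu.
rewrite (Ep_slope p1 lw cg gu) (eq_integral (fun x => (`|om x| `^ p)%:E))// => x _.
by rewrite /w mulrA mulfV ?mul1r// gt_eqF// slope_weight_gt0.
Qed.

End compactness.

(** * Existence of a minimizer *)

Lemma Ep_ge0 (R : realType) (p : R) (v w : R -> R) : (0 <= Ep p v w)%E.
Proof.
by apply: integral_ge0 => x _; rewrite lee_fin mulr_ge0 ?powR_ge0 ?sqrtr_ge0.
Qed.

(** [slope_primitive_bound] gives [2 |G (g x)| <= C^(1/p) < 2 G K], and the monotonicity of [G]
    converts this into a slope bound. *)
Lemma slope_bound (R : realType) (p C K x : R) (g om : R -> R) : 1 < p ->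
  0 <= K -> 0 <= C -> C `^ p^-1 < 2 * slope_primitive p K ->
  Lp01 p om -> primitive01 om (slope_primitive p \o g) ->
  Rintegral (@lebesgue_measure R) `[0, 1] (fun s => `|om s| `^ p) <= C ->
  (forall x, 0 <= x <= 1 -> g (1 - x) = - g x) -> 0 <= x <= 1 -> `|g x| <= K.
Proof.
move=> p1 K0 C0 CK lom omg omC anti x01; have p0 : 0 < p by exact: lt_trans p1.
apply: (slope_primitive_le_norm p1) => //; set a := `|_|.
have a0 : 0 <= 2 * a by rewrite mulr_ge0 ?normr_ge0.
suff : 2 * a <= C `^ p^-1 by lra.
have -> : 2 * a = ((2 * a) `^ p) `^ p^-1 by rewrite -powRrM mulfV ?powRr1// gt_eqF.
apply: ge0_ler_powR; rewrite ?nnegrE ?powR_ge0//; first by rewrite invr_ge0 ltW.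
by apply: le_trans omC; exact: slope_primitive_bound.
Qed.

Theorem theorem6p1 (R : realType) (p : R) (psi : R -> R)
  (hp : 1 < p)
  (hpsi : {within `[(0:R)%R, (1:R)%R], continuous psi})
  (hpsi0 : psi 0 < 0) (hpsi1 : psi 1 < 0)
  (hx0 : exists x0 : R, 0 < x0 < 1 /\ 0 < psi x0)
  (hinf : (ereal_inf (Esym_values p psi) < ((cp p) `^ p)%:E)%E) :
  exists u wu : R -> R,
    M_sym p psi u /\ W2p_with p u wu /\
    (forall v wv : R -> R, M_sym p psi v -> W2p_with p v wv ->
       (Ep p u wu <= Ep p v wv)%E).
Proof.
have p0 : 0 < p by exact: lt_trans hp.
set S := Esym_values p psi in hinf *.
have m0 : (0 <= ereal_inf S)%E.
  by apply: le_ereal_inf_tmp => _ [v [w [_ [_ ->]]]]; exact: Ep_ge0.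
have mfin : ereal_inf S \is a fin_num.
  by rewrite ge0_fin_numE//; apply: lt_trans hinf _; rewrite ltry.
pose m := fine (ereal_inf S).
have mE : ereal_inf S = m%:E by rewrite fineK.
have {}m0 : 0 <= m by rewrite -lee_fin -mE.
rewrite mE lte_fin in hinf.
(* [C] lies halfway between the infimum and the threshold: above [m] there is room for a minimizing
   sequence, and below [cp p ^ p] the slopes stay bounded. *)
pose C := (m + cp p `^ p) / 2; pose d := C - m.
have d0 : 0 < d by rewrite /d /C; lra.
have mC : C = m + d by rewrite /d; ring.
have C0 : 0 <= C by lra.
have Ccp : C < cp p `^ p by rewrite /C; lra.
have cp0 : 0 <= cp p.
  rewrite /cp mulr_ge0// fine_ge0//.
  by apply: integral_ge0 => x _; rewrite lee_fin powR_ge0.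
(* Since [C^(1/p) < cp p], some finite [K] already has [2 G K] above [C^(1/p)]; it will bound every
   slope of the sequence. *)
have [K K0 CK] : exists2 K, 0 <= K & C `^ p^-1 < 2 * slope_primitive p K.
  apply: (cp_lt_slope_primitive hp); first exact: powR_ge0.
  have -> : cp p = (cp p `^ p) `^ p^-1 by rewrite -powRrM mulfV ?powRr1// gt_eqF.
  by apply: gt0_ltr_powR; rewrite ?nnegrE ?invr_gt0 ?powR_ge0.
(* A triple holds a curve, its slope and the derivative of the transformed slope. The excess
   [d / (n + 1)] is at most [d], so all energies, including the one for [n = 0], are at most [C]. *)
have seqP n : exists t : (R -> R) * (R -> R) * (R -> R),
  [/\ M_sym p psi t.1.1, primitive01 t.1.2 t.1.1 /\ ucont01 t.1.2,
      Lp01 p t.2 /\ primitive01 t.2 (slope_primitive p \o t.1.2),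
      (forall x, 0 <= x <= 1 -> `|t.1.2 x| <= K) &
      Rintegral (@lebesgue_measure R) `[0, 1] (fun s => `|t.2 s| `^ p) <= m + d / n.+1%:R].
  have dn0 : 0 < d / n.+1%:R by rewrite divr_gt0.
  have : (ereal_inf S < (m + d / n.+1%:R)%:E)%E by rewrite mE lte_fin ltrDl.
  move=> /ereal_inf_lt[_ [v [w [Mv [Wv ->]]]]] Evw.
  have [lw [g [wg cg gv]]] := W2p_with_slope hp Wv.
  pose om s := slope_weight p (g s) * w s.
  have lom : Lp01 p om by exact: (Lp01_ucontM hp (slope_weight_ucont hp cg)).
  have omg : primitive01 om (slope_primitive p \o g) by exact: slope_primitive_chain.
  have anti x : 0 <= x <= 1 -> g (1 - x) = - g x.
    by apply: (primitive01_antisym gv cg); have [] := Mv.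
  have ome : Rintegral (@lebesgue_measure R) `[0, 1] (fun s => `|om s| `^ p) <= m + d / n.+1%:R.
    rewrite (Ep_slope hp lw cg gv) in Evw.
    rewrite -lee_fin /Rintegral fineK; first exact: ltW.
    rewrite ge0_fin_numE; first exact: (lt_trans Evw (ltry _)).
    by apply: integral_ge0 => x _; rewrite lee_fin powR_ge0.
  exists (v, g, om); split => //= x x01.
  apply: (slope_bound hp K0 C0 CK lom omg _ anti x01).
  apply: (le_trans ome); rewrite mC lerD2l ler_pdivrMr// ler_peMr ?ler1n//; exact: ltW.
have [t tP] := choice seqP.
have enC n : Rintegral (@lebesgue_measure R) `[0, 1] (fun s => `|(t n).2 s| `^ p) <= C.
  have [_ _ _ _ /le_trans] := tP n; apply.
  rewrite mC lerD2l ler_pdivrMr// ler_peMr ?ler1n//; exact: ltW.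
have enm e : 0 < e -> \forall n \near \oo,
    Rintegral (@lebesgue_measure R) `[0, 1] (fun s => `|(t n).2 s| `^ p) <= m + e.
  move=> e0; near=> n; have [_ _ _ _ /le_trans] := tP n; apply.
  rewrite lerD2l ler_pdivrMr// mulrC -ler_pdivrMr//.
  apply: ltW; apply: (lt_le_trans (truncnS_gt _)); rewrite ler_nat ltnS.
  by near: n; exists (Num.truncn (d / e)).
have [U [u [wu [UU ucv Wu Eu]]]] := @slope_compactness R p C K m
  (fun n => (t n).1.1) (fun n => (t n).1.2) (fun n => (t n).2) hp
  (fun n => let: And5 _ (conj H _) _ _ _ := tP n in H)
  (fun n => let: And5 _ (conj _ H) _ _ _ := tP n in H)
  (fun n => let: And5 _ _ (conj H _) _ _ := tP n in H)
  (fun n => let: And5 _ _ (conj _ H) _ _ := tP n in H)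
  (fun n => let: And5 _ _ _ H _ := tP n in H)
  (fun n => let: And5 (conj (conj _ (conj H _)) _) _ _ _ _ := tP n in H)
  enC enm.
have UP : ProperFilter U by exact: ultra_proper.
have Mt n : M_sym p psi (t n).1.1 by have [] := tP n.
have [x00 x11] : 0 <= (0 : R) <= 1 /\ 0 <= (1 : R) <= 1 by rewrite !lexx ler01.
have ulim x l : 0 <= x <= 1 -> (t n).1.1 x @[n --> U] --> l -> u x = l.
  by move=> x01 cl; exact: (cvg_unique (@Rhausdorff R) (ucv x x01) cl).
(* Boundary values, obstacle and symmetry are pointwise closed conditions, so they pass to the limit
   along [U]. *)
exists u, wu; split; [split; [split; [|split; [|split]]|]|split; [exact: Wu|]].
- by exists wu.
- apply: (ulim _ _ x00); apply: cvg_near_cst; apply: nearW => n.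
  by have [[_ []]] := Mt n.
- apply: (ulim _ _ x11); apply: cvg_near_cst; apply: nearW => n.
  by have [[_ [_ []]]] := Mt n.
- move=> x x01; apply: (cvgr_to_ge (ucv x x01)); apply: nearW => n.
  by have [[_ [_ [_ /(_ x x01)]]]] := Mt n.
- move=> x x01; apply: (ulim _ _ x01).
  have x01' : 0 <= 1 - x <= 1 by case/andP: x01 => *; apply/andP; split; lra.
  have -> : (fun n => (t n).1.1 x) = (fun n => (t n).1.1 (1 - x)).
    by apply/funext => n; have [_ ->] := Mt n.
  exact: ucv.
- move=> v wv Mv Wv; apply: (le_trans Eu); rewrite -mE.
  by apply: ereal_inf_lbound; exists v, wv.
Unshelve. all: by end_near. Qed.
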